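(* Let $\sigma:[t_0,\infty)\to(0,\infty)$, $1\le t_0<\infty$, be a generalized proximate order such that the function $\lambda(r)=\sigma\left(\frac1{1-r}\right)$ satisfies $1<\liminf_{r\to1^-}\lambda(r)<\limsup_{r\to1^-}\lambda(r)<\infty$. Let $\varepsilon>0$ and let $f$ be analytic in $\mathbb{D}=\{z\in\mathbb{C}:|z|<1\}$ such that $f(0)=0$ and $$\operatorname{Re} f(re^{i\theta})<\frac1{(1-r)^{\lambda(r)}},\qquad 0\le\theta<2\pi,\quad r_0<r<1,$$ for some $r_0\in(0,1)$ with $r_0\ge 1-\frac1{t_0}$. Then $$|\operatorname{Re} f(re^{i\theta})|<\frac1{(1-r)^{(1+\varepsilon)\lambda(r)}},\qquad 0\le\theta<2\pi,\quad r\to1^-,$$ that is, there exists $r_1\in(0,1)$ such that the inequality holds for all $r_1\le r<1$ and all $0\le\theta<2\pi$.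
   Context: A function $\sigma:[t_0,\infty)\to(0,\infty)$, $1\le t_0<\infty$, is called a generalized proximate order if $\sigma\in C^1[t_0,\infty)$, $\limsup_{t\to\infty}\sigma(t)$ and $\liminf_{t\to\infty}\sigma(t)$ are finite, and $\limsup_{t\to\infty}|\sigma'(t)|\,t\log t=0$. *)

(* Defs.v *)
From mathcomp Require Import all_boot all_order all_algebra.
From mathcomp Require Export complex.
From mathcomp Require Import all_classical all_reals all_analysis.

Set Implicit Arguments.
Unset Strict Implicit.
Unset Printing Implicit Defensive.

Import Order.TTheory GRing.Theory Num.Theory.
Import numFieldTopology.Exports numFieldNormedType.Exports.

Local Open Scope classical_set_scope.
Local Open Scope ring_scope.
Local Open Scope complex_scope.

(* [df] is the derivative of [f] on [t0, +oo[ and is continuous there; the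
   quotients are restricted to [t0, +oo[, so the derivative is one-sided at t0. *)
Definition C1_ray (R : realType) (t0 : R) (f df : R -> R) : Prop :=
  (forall t, t0 <= t ->
     (f s - f t) / (s - t) @[s --> within `[t0, +oo[ t^'] --> df t) /\
  {within `[t0, +oo[, continuous df}.

(* [sigma] is a total function of which only the values on [t0, +oo[ matter. *)
Definition generalized_proximate_order (R : realType) (t0 : R)
    (sigma : R -> R) : Prop :=
  [/\ 1 <= t0,
      forall t, t0 <= t -> 0 < sigma t,
      limf_esup (EFin \o sigma) +oo \is a fin_num,
      limf_einf (EFin \o sigma) +oo \is a fin_num &
      exists2 dsigma : R -> R, C1_ray t0 sigma dsigma &
        limf_esup (fun t => (`|dsigma t| * t * ln t)%:E) +oo = 0%E].

(* The scalars are R[i]: the increments tend to 0 through complex numbers, so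
   this is complex differentiability at every point of the open unit disc. *)
Definition analytic_in_disc (R : realType) (f : R[i] -> R[i]) : Prop :=
  forall z : R[i], `|z| < 1 -> derivable (f : R[i]^o -> R[i]^o) z 1.

(* r * e^(i theta) *)
Definition polar (R : realType) (r theta : R) : R[i] :=
  (r * cos theta) +i* (r * sin theta).

(* Main.v *)
Require Import Defs.
From mathcomp Require Import all_boot all_order all_algebra complex.
From mathcomp Require Import all_classical all_reals all_analysis.
From mathcomp Require Import ring lra.

(** Write [u] for the real part of [f] and [V t = t ^ sigma t], so that
    [u < V (1 / (1 - |z|))] near the unit circle.  Only the lower bound needs
    work: the upper one follows from [V <= V ^ (1 + eps)].

    Since [|sigma'| t log t -> 0] and [sigma > 1 + c] eventually, [V t / t] is
    nondecreasing for large [t] ([order_log_mono]), and [sigma (2 t)] exceeds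
    [sigma t] by at most a given [e] ([order_double]).

    The bound from below on [u] comes from Harnack's inequality on small discs.
    Fix a direction [theta], a large number [N], and let [d] be small.  The disc
    of centre [(1 - N d) e^(i theta)] and radius [(N - 1/2) d] keeps a distance
    [d / 2] from the unit circle, hence [M - u >= 0] there with [M = V (2 / d)].
    Comparing the centre with the point [(1 - d) e^(i theta)], Harnack gives
      [M - u ((1 - d) e^(i theta)) <= 4 N (M - u ((1 - N d) e^(i theta)))].
    Multiplied by [d], each step from distance [d] to distance [N d] therefore
    costs a factor 4 only, not a factor [4 N]; iterating until the distance is
    of constant size takes [k ~ log (1/d) / log N] steps, and the accumulated
    factor is at most [5 ^ k] ([lower_bound_iter]).  With [N = 5 ^ P] this is
    at most [(1/d) ^ (1/P)], an arbitrarily small power of [1/d], which together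
    with the constants is absorbed by the exponent [1 + eps]
    ([absorb_constants]).  The recursion starts from Harnack's inequality on a
    disc centred at 0, where [f 0 = 0] is used.

    Harnack's inequality is derived from complex differentiability alone.
    Goursat's bisection argument on rectangles, applied to [F (exp (x + i y))]
    over one period in [y], shows that the mean of [F] over concentric circles
    is constant, also across a circle on which [F] is merely continuous
    ([mean_value]).  The function
      [(K w - K s) (1 - s^2) w / ((w - s) (1 - s w))]
    vanishes at 0 and, on the unit circle, equals [K - K s] times the Poisson
    kernel; its mean value is the Poisson formula, from which Harnack's
    inequality follows by bounding the kernel. *)

Set Implicit Arguments.
Unset Strict Implicit.
Unset Printing Implicit Defensive.

Import Order.TTheory GRing.Theory Num.Theory.
Import numFieldTopology.Exports numFieldNormedType.Exports.

Local Open Scope classical_set_scope.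
Local Open Scope ring_scope.

(** * Integrals of continuous functions on a segment *)

Section IntervalIntegral.
Context {R : realType}.
Notation mu := (@lebesgue_measure R).

(** Continuity is two-sided even at the end points, so that it can be derived
    from complex differentiability without subspace topologies. *)
Definition continuous_on (a b : R) (g : R -> R) :=
  forall x, a <= x <= b -> {for x, continuous g}.

Definition segint (a b : R) (g : R -> R) := (\int[mu]_(x in `[a, b]) g x)%R.

Lemma continuous_on_within a b g :
  continuous_on a b g -> {within `[a, b], continuous g}.
Proof.
move=> cg; apply: continuous_in_subspaceT => x /set_mem/=.
by rewrite in_itv/= => xab; exact: cg.
Qed.

Lemma continuous_on_integrable a b g :
  continuous_on a b g -> mu.-integrable `[a, b] (EFin \o g).
Proof.
move=> cg; apply: continuous_compact_integrable; first exact: segment_compact.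
exact: continuous_on_within.
Qed.

Lemma continuous_on_sub a b c d g : a <= c -> d <= b ->
  continuous_on a b g -> continuous_on c d g.
Proof.
by move=> ac db cg x /andP[cx xd]; apply: cg; rewrite (le_trans ac)//= (le_trans xd).
Qed.

Lemma segint_split a m b g : a <= m -> m <= b -> continuous_on a b g ->
  segint a b g = segint a m g + segint m b g.
Proof.
move=> am mb cg; rewrite /segint.
have := @Rintegral_itvB R g (BLeft a) (BRight b) m (continuous_on_integrable cg).
rewrite !bnd_simp => /(_ am mb) /eqP; rewrite subr_eq => /eqP ->.
rewrite addrC Rintegral_itv_obnd_cbnd//.
apply: integrableS (continuous_on_integrable cg) => //.
by apply: subset_itvr; rewrite bnd_simp.
Qed.

Lemma segintB a b f g : continuous_on a b f -> continuous_on a b g ->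
  segint a b (fun x => f x - g x) = segint a b f - segint a b g.
Proof. by move=> cf cg; rewrite /segint RintegralB//; exact: continuous_on_integrable. Qed.

Lemma segintZ a b k f : continuous_on a b f ->
  segint a b (fun x => k * f x) = k * segint a b f.
Proof. by move=> cf; rewrite /segint RintegralZl//; exact: continuous_on_integrable. Qed.

Lemma eq_segint a b f g : (forall x, a <= x <= b -> f x = g x) ->
  segint a b f = segint a b g.
Proof.
by move=> fg; apply: eq_Rintegral => x /set_mem/=; rewrite in_itv/=; exact: fg.
Qed.

Lemma segint_cst a b k : a <= b -> segint a b (fun=> k) = k * (b - a).
Proof.
move=> ab; rewrite /segint Rintegral_cst//= lebesgue_measure_itv/= lte_fin.
by move: ab; rewrite le_eqVlt => /predU1P[->|->//]; rewrite ltxx subrr.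
Qed.

Lemma continuous_on_cst a b k : continuous_on a b (fun=> k).
Proof. by move=> x _; exact: cvg_cst. Qed.

Lemma continuous_onB a b f g : continuous_on a b f -> continuous_on a b g ->
  continuous_on a b (fun x => f x - g x).
Proof. by move=> cf cg x xab; apply: continuousB; [exact: cf|exact: cg]. Qed.

Lemma continuous_onZ a b k f : continuous_on a b f ->
  continuous_on a b (fun x => k * f x).
Proof. by move=> cf x xab; apply: continuousM; [exact: cvg_cst|exact: cf]. Qed.

Lemma le_segint a b f g : continuous_on a b f -> continuous_on a b g ->
  (forall x, a <= x <= b -> f x <= g x) -> segint a b f <= segint a b g.
Proof.
move=> cf cg fg; apply: le_Rintegral => //; exact: continuous_on_integrable.
Qed.

(** Goursat's argument compares differences of [q] and [p] on opposite sides of a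
    small rectangle with their first-order approximation, which is a constant. *)
Lemma segint_near_cst a b k e g : a <= b -> continuous_on a b g ->
  (forall x, a <= x <= b -> `|g x - k| <= e) ->
  `|segint a b g - k * (b - a)| <= e * (b - a).
Proof.
move=> ab cg ge.
have ck t : continuous_on a b (fun=> t) by exact: continuous_on_cst.
have -> : segint a b g - k * (b - a) = segint a b (fun x => g x - k).
  by rewrite segintB// segint_cst.
have cgk := continuous_onB cg (ck k).
rewrite ler_norml -mulNr -!(segint_cst _ ab).
apply/andP; split; apply: le_segint => // x /ge; by rewrite ler_norml => /andP[].
Qed.

End IntervalIntegral.

(** * Complex differentiability with real error terms *)

Section ComplexBasics.
Import Normc.
Local Open Scope complex_scope.
Context {R : realType}.
Implicit Types (z w h : R[i]) (F G : R[i] -> R[i]).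

Definition Cdiff G z := derivable (G : R[i]^o -> R[i]^o) z 1.

Lemma normE z : `|z| = (normc z)%:C. Proof. by []. Qed.

Lemma normc_ge0 z : 0 <= normc z.
Proof. by case: z => a b /=; exact: sqrtr_ge0. Qed.

Lemma normc_gt0 z : (0 < normc z) = (z != 0).
Proof. by rewrite -normr_gt0 normE ltcR. Qed.

Lemma Re_normc z : `|complex.Re z| <= normc z.
Proof. by rewrite -lecR -normE normc_ge_Re. Qed.

Lemma Im_normc z : `|complex.Im z| <= normc z.
Proof.
case: z => a b /=; rewrite -sqrtr_sqr; apply: ler_wsqrtr.
by rewrite lerDr sqr_ge0.
Qed.

Lemma normc_le_ReIm z : normc z <= `|complex.Re z| + `|complex.Im z|.
Proof.
case: z => a b /=; rewrite -[leRHS]ger0_norm ?addr_ge0// -sqrtr_sqr.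
apply: ler_wsqrtr; rewrite sqrrD !real_normK ?num_real//.
by rewrite -addrA lerD2l lerDr mulrn_wge0// mulr_ge0.
Qed.

(** The norm of [R[i]] takes its values in [R[i]]; stating the first-order
    expansion with the real-valued [normc] allows all later estimates to take
    place in [R]. *)
Lemma Cdiff_expansion G z : Cdiff G z -> exists D : R[i],
  forall e : R, 0 < e -> exists2 d : R, 0 < d &
    forall h, normc h < d -> normc (G (z + h) - G z - D * h) <= e * normc h.
Proof.
move=> /cvg_ex[D /= GD]; exists D => e e0.
have e0' : 0 < e%:C by rewrite ltcR.
move/cvgrPdist_le : GD => /(_ _ e0').
rewrite /dnbhs/= => -[[d1 d2]] /=.
rewrite ltcE/= => /andP[/eqP -> d0] H; exists d1 => // h hd.
have [->|h0] := eqVneq h 0.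
  by rewrite addr0 mulr0 subr0 subrr normc0 mulr0.
have := H h; rewrite /ball_ /= sub0r normrN normE ltcR => /(_ hd h0).
rewrite normE lecR /= [_ *: 1]mulr1 => He.
have -> : G (z + h) - G z - D * h = - ((D - h^-1 * (G (h + z) - G z)) * h).
  rewrite (addrC h) mulrBl mulrAC mulVf// mul1r; ring.
by rewrite normcN normcM ler_wpM2r ?normc_ge0.
Qed.

End ComplexBasics.

(** * Goursat's lemma on a rectangle *)

(** Only the left ends and the lengths are recorded, because the bisection
    below fixes the lengths in advance. *)
Lemma nested_intervals {R : realType} (a w : nat -> R) :
  (forall n, 0 <= w n) -> (forall n, a n <= a n.+1) ->
  (forall n, a n.+1 + w n.+1 <= a n + w n) ->
  exists x, forall n, a n <= x <= a n + w n.
Proof.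
move=> w0 aS awS.
have amono n m : (n <= m)%N -> a n <= a m by apply: (homo_leq le_refl le_trans aS).
have awmono n m : (n <= m)%N -> a m + w m <= a n + w n.
  apply: (@homo_leq _ (fun n => a n + w n) (fun x y => y <= x)) => //.
  by move=> y x z h1 h2; exact: le_trans h1.
have ub n m : a m <= a n + w n.
  have [nm|/ltnW mn] := leqP n m.
    by apply: le_trans (awmono _ _ nm); rewrite lerDl.
  by apply: le_trans (amono _ _ mn) _; rewrite lerDl.
exists (sup (range a)) => n; apply/andP; split.
  apply: ub_le_sup; last by exists n.
  by exists (a 0%N + w 0%N) => _ [m _ <-].
by apply: ge_sup; [exists (a 0%N); exists 0%N|move=> _ [m _ <-]].
Qed.

Section Goursat.
Context {R : realType}.
Variables (q p : R -> R -> R) (A B C D : R).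
Hypotheses (AB : A <= B) (CD : C <= D).
Hypothesis cq : forall x, A <= x <= B -> continuous_on C D (q x).
Hypothesis cp : forall y, C <= y <= D -> continuous_on A B (p ^~ y).
Hypothesis loc : forall x y, A <= x <= B -> C <= y <= D ->
  exists al be : R, forall e, 0 < e -> exists2 d, 0 < d &
    forall x' y', `|x' - x| < d -> `|y' - y| < d ->
    `|q x' y' - q x y - (al * (x' - x) - be * (y' - y))|
       <= e * (`|x' - x| + `|y' - y|) /\
    `|p x' y' - p x y - (be * (x' - x) + al * (y' - y))|
       <= e * (`|x' - x| + `|y' - y|).

(** The integral of [p dx + q dy] along the boundary of the rectangle, that is
    the imaginary part of the contour integral of [q + i p]. *)
Definition circulation a b c d :=
  segint c d (fun y => q b y - q a y) - segint a b (fun x => p x d - p x c).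
Local Notation J := circulation.

Lemma circulation_split a m b c n d :
  A <= a -> a <= m -> m <= b -> b <= B -> C <= c -> c <= n -> n <= d -> d <= D ->
  J a b c d = (J a m c n + J m b c n) + (J a m n d + J m b n d).
Proof.
move=> Aa am mb bB Cc cn nd dD.
have Qa x c' d' : a <= x -> x <= b -> c <= c' -> d' <= d ->
    continuous_on c' d' (q x).
  move=> ax xb cc' dd'; apply: continuous_on_sub (cq _).
  - exact: le_trans cc'.
  - exact: le_trans dd' _.
  - by rewrite (le_trans Aa)// (le_trans xb).
have Pa y a' b' : c <= y -> y <= d -> a <= a' -> b' <= b ->
    continuous_on a' b' (p ^~ y).
  move=> cy yd aa' bb'; apply: continuous_on_sub (cp _).
  - exact: le_trans aa'.
  - exact: le_trans bb' _.
  - by rewrite (le_trans Cc)// (le_trans yd).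
have ab := le_trans am mb; have cd := le_trans cn nd.
rewrite /J !segintB//; do 1?[by apply: Qa]; do 1?[by apply: Pa].
rewrite !(@segint_split _ c n d)//; do 1?[by apply: Qa].
rewrite !(@segint_split _ a m b)//; do 1?[by apply: Pa].
ring.
Qed.

(** The affine part of [(q, p)] is closed, because the coefficient [al] of [x]
    in [q] is also that of [y] in [p]; only the remainder contributes, at most
    its size times the perimeter. *)
Lemma circulation_small (al be e x y a b c d : R) : a <= x <= b -> c <= y <= d ->
  A <= a -> b <= B -> C <= c -> d <= D -> 0 <= e ->
  (forall x' y', a <= x' <= b -> c <= y' <= d ->
    `|q x' y' - q x y - (al * (x' - x) - be * (y' - y))|
       <= e * ((b - a) + (d - c)) /\
    `|p x' y' - p x y - (be * (x' - x) + al * (y' - y))|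
       <= e * ((b - a) + (d - c))) ->
  `|J a b c d| <= 2 * e * ((b - a) + (d - c)) ^+ 2.
Proof.
move=> /andP[ax xb] /andP[cy yd] Aa bB Cc dD e0 H.
have ab := le_trans ax xb; have cd := le_trans cy yd.
have h1 : `|segint c d (fun y => q b y - q a y) - al * (b - a) * (d - c)| <=
    2 * e * ((b - a) + (d - c)) * (d - c).
  apply: segint_near_cst => //.
    apply: continuous_onB; apply: continuous_on_sub (cq _) => //.
      by rewrite (le_trans Aa).
    by rewrite Aa (le_trans ab).
  move=> y' cyd.
  have [] := H b y' _ cyd; first by rewrite ab lexx.
  have [] := H a y' _ cyd; first by rewrite ab lexx.
  by rewrite !ler_norml => ? _ ? _; lra.
have h2 : `|segint a b (fun x => p x d - p x c) - al * (d - c) * (b - a)| <=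
    2 * e * ((b - a) + (d - c)) * (b - a).
  apply: segint_near_cst => //.
    apply: continuous_onB; apply: continuous_on_sub (cp _) => //.
      by rewrite (le_trans Cc).
    by rewrite Cc (le_trans cd).
  move=> x' axb.
  have [] := H x' d axb; first by rewrite cd lexx.
  have [] := H x' c axb; first by rewrite cd lexx.
  by rewrite !ler_norml => _ ? _ ?; lra.
rewrite /J; move: h1 h2; set I1 := segint _ _ _; set I2 := segint _ _ _.
rewrite !ler_norml => h1 h2; lra.
Qed.

(** The rectangles of generation [n] all have width [w n] and height [h n], so a
    rectangle is given by its lower left corner.  The step keeps a quarter that
    carries at least a quarter of the circulation. *)
Let w n := (B - A) / 2 ^+ n.
Let h n := (D - C) / 2 ^+ n.
Let Jn n (z : R * R) := J z.1 (z.1 + w n) z.2 (z.2 + h n).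
Let step n (z : R * R) : R * R :=
  let z1 := (z.1 + w n.+1, z.2) in
  let z2 := (z.1, z.2 + h n.+1) in
  let z3 := (z.1 + w n.+1, z.2 + h n.+1) in
  if `|Jn n z| <= 4 * `|Jn n.+1 z| then z else
  if `|Jn n z| <= 4 * `|Jn n.+1 z1| then z1 else
  if `|Jn n z| <= 4 * `|Jn n.+1 z2| then z2 else z3.
Fixpoint corner n := if n is m.+1 then step m (corner m) else (A, C).

Let w2 n : w n = w n.+1 + w n.+1.
Proof. by rewrite /w exprS; field; rewrite expf_neq0. Qed.
Let h2 n : h n = h n.+1 + h n.+1.
Proof. by rewrite /h exprS; field; rewrite expf_neq0. Qed.
Let w0 n : 0 <= w n.
Proof. by rewrite /w divr_ge0 ?subr_ge0// exprn_ge0. Qed.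
Let h0 n : 0 <= h n.
Proof. by rewrite /h divr_ge0 ?subr_ge0// exprn_ge0. Qed.

Let inside n (z : R * R) :=
  [/\ A <= z.1, z.1 + w n <= B, C <= z.2 & z.2 + h n <= D].

Let stepP n z : inside n z ->
  [/\ inside n.+1 (step n z),
    z.1 <= (step n z).1, (step n z).1 + w n.+1 <= z.1 + w n,
    z.2 <= (step n z).2 & (step n z).2 + h n.+1 <= z.2 + h n] /\
  `|Jn n z| <= 4 * `|Jn n.+1 (step n z)|.
Proof.
case: z => a c [/= Aa aB Cc cD].
have := w0 n.+1; have := h0 n.+1; have := w2 n; have := h2 n => eh ew hp wp.
have := @circulation_split a (a + w n.+1) (a + w n) c (c + h n.+1) (c + h n).
rewrite !lerD2l !lerDl !ew !eh !lerDr hp wp -ew -eh Aa aB Cc cD.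
move=> /(_ isT isT isT isT isT isT isT isT).
move=> Jsplit.
have e1 : Jn n.+1 (a + w n.+1, c) = J (a + w n.+1) (a + w n) c (c + h n.+1).
  by rewrite /Jn /= ew addrA.
have e2 : Jn n.+1 (a, c + h n.+1) = J a (a + w n.+1) (c + h n.+1) (c + h n).
  by rewrite /Jn /= eh addrA.
have e3 : Jn n.+1 (a + w n.+1, c + h n.+1) =
    J (a + w n.+1) (a + w n) (c + h n.+1) (c + h n).
  by rewrite /Jn /= ew eh !addrA.
rewrite /step /=; case: ifPn => [|J0]; [|case: ifPn => [|J1]; [|case: ifPn => [|J2]]].
- move=> J0; split => //; split => //=; try split => //=; lra.
- move=> J0'; split => //; split => //=; try split => //=; lra.
- move=> J0'; split => //; split => //=; try split => //=; lra.
- split; first by split => //=; try split => //=; lra.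
  move: J0 J1 J2; rewrite -!ltNge e1 e2 e3 /Jn /= Jsplit.
  set x1 := J _ _ _ _; set x2 := J _ _ _ _; set x3 := J _ _ _ _; set x4 := J _ _ _ _.
  have := ler_normD (x1 + x2) (x3 + x4); have := ler_normD x3 x4.
  have := ler_normD x1 x2; lra.
Qed.

Let corner_inside n : inside n (corner n).
Proof.
elim: n => [|n /stepP[[]]//]; split => //=;
  by rewrite ?lexx// /w /h expr0 divr1 addrC subrK.
Qed.

Let circulation_le n : `|J A B C D| <= 4 ^+ n * `|Jn n (corner n)|.
Proof.
elim: n => [|n IH].
  by rewrite expr0 mul1r /Jn /= /w /h expr0 !divr1 ![_ + (_ - _)]addrC !subrK.
have [_ S] := stepP (corner_inside n).
by rewrite exprSr -mulrA; apply: le_trans IH _; rewrite ler_wpM2l// exprn_ge0.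
Qed.

(** At generation [n] the circulation is at least [4 ^ - n] times the initial one,
    whereas differentiability at the limit point makes it [o (4 ^ - n)]. *)
Theorem goursat_rectangle : J A B C D = 0.
Proof.
have [x xP] : exists x, forall n, (corner n).1 <= x <= (corner n).1 + w n.
  by apply: nested_intervals => // n; have [[_ ? ? _ _] _] := stepP (corner_inside n).
have [y yP] : exists y, forall n, (corner n).2 <= y <= (corner n).2 + h n.
  by apply: nested_intervals => // n; have [[_ _ _ ? ?] _] := stepP (corner_inside n).
have Ax : A <= x <= B by have := xP 0%N; rewrite /= /w expr0 divr1 addrC subrK.
have Cy : C <= y <= D by have := yP 0%N; rewrite /= /h expr0 divr1 addrC subrK.
have [al [be exp]] := loc Ax Cy.
set S := (B - A) + (D - C).
have S0 : 0 <= S by rewrite addr_ge0// subr_ge0.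
have small e : 0 < e -> `|J A B C D| <= 2 * e * S ^+ 2.
  move=> e0; have [d d0 H] := exp e e0.
  have [n nd] : exists n, S / 2 ^+ n < d.
    have := @cvg_geometric R S (2^-1).
    rewrite ger0_norm ?invf_lt1 ?ltr1n// => /(_ isT) /cvgrPdist_lt/(_ _ d0)[n _ /(_ n (leqnn _))].
    rewrite sub0r normrN /geometric /= exprVn => Hn.
    by exists n; apply: le_lt_trans Hn; exact: ler_norm.
  have [i1 i2 i3 i4] := corner_inside n.
  have wh : w n + h n = S / 2 ^+ n by rewrite /w /h /S; ring.
  have := w0 n; have := h0 n => hn wn.
  have Jb : `|Jn n (corner n)| <= 2 * e * (w n + h n) ^+ 2.
    have -> : w n + h n = ((corner n).1 + w n - (corner n).1) +
                          ((corner n).2 + h n - (corner n).2) by ring.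
    apply: (circulation_small (al := al) (be := be) (xP n) (yP n)) => //.
      exact: ltW.
    move=> x' y' x'P y'P; have := xP n; have := yP n => yn xn.
    have x'x : `|x' - x| <= w n by rewrite ler_norml; lra.
    have y'y : `|y' - y| <= h n by rewrite ler_norml; lra.
    have x'd : `|x' - x| < d by lra.
    have y'd : `|y' - y| < d by lra.
    have [h1 h2'] := H x' y' x'd y'd.
    split; [apply: le_trans h1 _|apply: le_trans h2' _]; rewrite ler_pM2l//;
      lra.
  apply: le_trans (circulation_le n) _.
  apply: le_trans (ler_wpM2l _ Jb) _; first by rewrite exprn_ge0.
  rewrite wh (_ : 4 = 2 ^+ 2); last by ring.
  rewrite -exprM mulnC exprM le_eqVlt; apply/orP; left; apply/eqP.
  by field; rewrite expf_neq0.
apply/eqP; rewrite -normr_eq0 eq_le normr_ge0 andbT leNgt; apply/negP => J0.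
have S2 : 0 <= S ^+ 2 by rewrite exprn_ge0.
have e0 : 0 < `|J A B C D| / (4 * (S ^+ 2 + 1)) by rewrite divr_gt0//; lra.
have := small _ e0.
have -> : 2 * (`|J A B C D| / (4 * (S ^+ 2 + 1))) * S ^+ 2 =
  (`|J A B C D| * S ^+ 2 / (S ^+ 2 + 1)) / 2 by field; lra.
rewrite leNgt => /negP; apply.
rewrite ltr_pdivrMr// ltr_pdivrMr; last by lra.
nra.
Qed.

End Goursat.

(** * The complex exponential *)

Section ComplexExp.
Import Normc.
Local Open Scope complex_scope.
Context {R : realType}.
Implicit Types (z w h : R[i]) (F G : R[i] -> R[i]).

Definition Ccont G z := {for z, continuous (G : R[i]^o -> R[i]^o)}.

Lemma Ccont_eps G z : Ccont G z -> forall e : R, 0 < e ->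
  exists2 d : R, 0 < d & forall w, normc (w - z) < d -> normc (G w - G z) < e.
Proof.
move=> cG e e0; have e0' : 0 < e%:C by rewrite ltcR.
move/cvgrPdist_lt : cG => /(_ _ e0').
move=> [[d1 d2]] /=.
rewrite ltcE/= => /andP[/eqP -> d0] H; exists d1 => // w wd.
have := H w; rewrite /ball_ /= distrC normE ltcR => /(_ wd).
by rewrite distrC normE ltcR.
Qed.

Lemma Cdiff_cont G z : Cdiff G z -> Ccont G z.
Proof. by move=> /derivable1_diffP/differentiable_continuous. Qed.

Lemma expansion_Cdiff G z D :
  (forall e : R, 0 < e -> exists2 d : R, 0 < d &
    forall h, normc h < d -> normc (G (z + h) - G z - D * h) <= e * normc h) ->
  Cdiff G z.
Proof.
move=> H; apply/cvg_ex; exists D; apply/cvgrPdist_le => -[e1 e2] /=.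
rewrite ltcE/= => /andP[/eqP -> e0]; have [d d0 {}H] := H _ e0.
exists (d%:C); first by rewrite /= ltcR.
move=> h; rewrite /ball_ /= sub0r normrN normE ltcR => hd h0.
rewrite /= [_ *: 1]mulr1 normE lecR.
have h0' : 0 < normc h by rewrite normc_gt0.
rewrite -(ler_pM2r h0') -normcM; apply: le_trans (H h hd).
rewrite -normcN -mulNr opprB mulrBl (_ : h^-1 *: _ * h = G (h + z) - G z).
  by rewrite (addrC h).
by rewrite /GRing.scale /= mulrAC mulVf// mul1r.
Qed.

Lemma is_derive_expansion (f : R -> R) (x df : R) : is_derive x 1 f df ->
  forall e : R, 0 < e -> exists2 d : R, 0 < d &
    forall h : R, `|h| < d -> `|f (x + h) - f x - df * h| <= e * `|h|.
Proof.
move=> [/cvg_ex[D fD]]; rewrite /derive (cvg_lim _ fD)// => Ddf e e0.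
move/cvgrPdist_le : fD => /(_ _ e0) [d /= d0 H]; exists d => // h hd.
have [->|h0] := eqVneq h 0.
  by rewrite addr0 mulr0 subr0 subrr normr0 mulr0.
have := H h; rewrite /ball_ /= sub0r normrN => /(_ hd h0).
rewrite [_ *: 1]mulr1 Ddf => He.
have -> : f (x + h) - f x - df * h = - ((df - h^-1 *: (f (h + x) - f x)) * h).
  by rewrite mulrBl /GRing.scale/= mulrAC mulVf// mul1r (addrC h); ring.
by rewrite normrN normrM ler_wpM2r.
Qed.

(** The exponential gives polar coordinates in which circles become vertical
    segments, so that Goursat's lemma for rectangles applies to annuli. *)
Definition cexp z : R[i] := polar (expR (complex.Re z)) (complex.Im z).

Lemma cexpD z w : cexp (z + w) = cexp z * cexp w.
Proof.
case: z => a b; case: w => c d; rewrite /cexp /polar /=; simpc => /=.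
by rewrite expRD cosD sinD; congr (_ +i* _); ring.
Qed.

Lemma normc_cexp z : normc (cexp z) = expR (complex.Re z).
Proof.
rewrite /cexp /polar /= !exprMn -mulrDr cos2Dsin2 mulr1 sqrtr_sqr ger0_norm// expR_ge0.
Qed.

(** By the addition formula this expansion at 0 gives the derivative everywhere. *)
Lemma cexp_expansion0 (e : R) : 0 < e -> exists2 d : R, 0 < d &
    forall h, normc h < d -> normc (cexp h - 1 - h) <= e * normc h.
Proof.
move=> e0; have e6 : 0 < e / 6 by rewrite divr_gt0.
(* The remainder is a sum of these real errors, with total weight at most 6. *)
have [d1 d10 H1] := is_derive_expansion (is_derive_expR 0) e6.
have [d2 d20 H2] := is_derive_expansion (is_derive_cos 0) e6.
have [d3 d30 H3] := is_derive_expansion (is_derive_sin 0) e6.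
have [d4 d40 H4] := is_derive_expansion (is_derive_expR 0) (ltr01 : 0 < 1).
exists (Num.min (Num.min d1 d2) (Num.min (Num.min d3 d4) (Num.min (1/2) (e / 12)))).
  by rewrite !lt_min d10 d20 d30 d40 !divr_gt0.
case=> x y; rewrite !lt_min.
move=> /andP[/andP[xd1 xd2] /andP[/andP[xd3 xd4] /andP[xd5 xd6]]].
set z := x +i* y in xd1 xd2 xd3 xd4 xd5 xd6 *.
have xz : `|x| <= normc z := Re_normc z.
have yz : `|y| <= normc z := Im_normc z.
have := H1 x (le_lt_trans xz xd1); rewrite add0r expR0 mul1r => hx.
have := H4 x (le_lt_trans xz xd4); rewrite add0r expR0 !mul1r => hx4.
have := H2 y (le_lt_trans yz xd2); rewrite add0r cos0 sin0 oppr0 mul0r subr0 => hc.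
have := H3 y (le_lt_trans yz xd3); rewrite add0r cos0 sin0 subr0 mul1r => hs.
have ex1 : `|expR x - 1| <= 2 * `|x|.
  have := ler_normD (expR x - 1 - x) x; rewrite subrK => /le_trans; apply; lra.
have ex2 : expR x <= 2.
  have := ltW (le_lt_trans xz xd5) => xe.
  by move: ex1; rewrite ler_norml; lra.
have ex0 := expR_ge0 x.
rewrite -/z; apply: le_trans (normc_le_ReIm _) _.
have [-> ->] : complex.Re (cexp z - 1 - z) = expR x * cos y - 1 - x /\
    complex.Im (cexp z - 1 - z) = expR x * sin y - 0 - y by [].
have -> : expR x * cos y - 1 - x = (expR x - 1 - x) + expR x * (cos y - 1) by ring.
have -> : expR x * sin y - 0 - y = expR x * (sin y - y) + (expR x - 1) * y by ring.
have := ler_normD (expR x - 1 - x) (expR x * (cos y - 1)).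
have := ler_normD (expR x * (sin y - y)) ((expR x - 1) * y).
rewrite !normrM (ger0_norm ex0) => h1 h2.
have h3 : expR x * `|cos y - 1| <= 2 * (e / 6 * `|y|) by apply: ler_pM.
have h4 : expR x * `|sin y - y| <= 2 * (e / 6 * `|y|) by apply: ler_pM.
have h5 : `|expR x - 1| * `|y| <= e / 6 * `|y|.
  have := ltW (le_lt_trans xz xd6) => xe.
  by apply: ler_wpM2r => //; apply: le_trans ex1 _; lra.
have h6 : e * `|x| <= e * normc z by rewrite ler_pM2l.
have h7 : e * `|y| <= e * normc z by rewrite ler_pM2l.
have := normr_ge0 x; have := normr_ge0 y; lra.
Qed.

Lemma Cdiff_cexp z : Cdiff cexp z.
Proof.
apply: (@expansion_Cdiff _ _ (cexp z)) => e e0.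
have n0 : 0 < normc (cexp z) by rewrite normc_cexp expR_gt0.
have [d d0 H] := cexp_expansion0 (divr_gt0 e0 n0).
exists d => // h /H He.
have -> : cexp (z + h) - cexp z - cexp z * h = cexp z * (cexp h - 1 - h).
  by rewrite cexpD; ring.
rewrite normcM (le_trans (ler_wpM2l (ltW n0) He))//.
by rewrite le_eqVlt; apply/orP; left; apply/eqP; field; rewrite gt_eqF.
Qed.

Lemma Cdiff_comp F G z : Cdiff G z -> Cdiff F (G z) -> Cdiff (F \o G) z.
Proof.
rewrite /Cdiff => /derivable1_diffP dG /derivable1_diffP dF.
by apply/derivable1_diffP; exact: (differentiable_comp dG dF).
Qed.

Lemma Ccont_joint G x y : Ccont G (x +i* y) -> forall e : R, 0 < e ->
  exists2 d : R, 0 < d & forall x' y', `|x' - x| < d -> `|y' - y| < d ->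
    normc (G (x' +i* y') - G (x +i* y)) < e.
Proof.
move=> /Ccont_eps H e /H[d d0 {}H]; exists (d / 2); first by rewrite divr_gt0.
move=> x' y' xd yd; apply: H; apply: le_lt_trans (normc_le_ReIm _) _ => /=; lra.
Qed.

Lemma normc_Re_lt z w (e : R) : normc (z - w) < e -> `|complex.Re z - complex.Re w| < e.
Proof. by apply: le_lt_trans; have := Re_normc (z - w); case: z; case: w. Qed.

Lemma normc_Im_lt z w (e : R) : normc (z - w) < e -> `|complex.Im z - complex.Im w| < e.
Proof. by apply: le_lt_trans; have := Im_normc (z - w); case: z; case: w. Qed.

(** The expansion of [G] with derivative [al + i be] has real part
    [al dx - be dy] and imaginary part [be dx + al dy], which is the form
    required by [goursat_rectangle]. *)
Lemma goursat_Cdiff G (a b c d : R) : a <= b -> c <= d ->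
  (forall x y, a <= x <= b -> c <= y <= d -> Cdiff G (x +i* y)) ->
  segint c d (fun y => complex.Re (G (b +i* y)) - complex.Re (G (a +i* y))) =
  segint a b (fun x => complex.Im (G (x +i* d)) - complex.Im (G (x +i* c))).
Proof.
move=> ab cd dG; apply/eqP; rewrite -subr_eq0; apply/eqP.
apply: (@goursat_rectangle _ (fun x y => complex.Re (G (x +i* y)))
  (fun x y => complex.Im (G (x +i* y)))) => //.
- move=> x xab y ycd; apply/cvgrPdist_lt => e e0.
  have [r r0 H] := Ccont_joint (Cdiff_cont (dG x y xab ycd)) e0.
  exists r => // y'; rewrite /ball_/= => yy'; rewrite distrC.
  by apply: normc_Re_lt; apply: H; [rewrite subrr normr0|rewrite distrC].
- move=> y ycd x xab; apply/cvgrPdist_lt => e e0.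
  have [r r0 H] := Ccont_joint (Cdiff_cont (dG x y xab ycd)) e0.
  exists r => // x'; rewrite /ball_/= => xx'; rewrite distrC.
  by apply: normc_Im_lt; apply: H; [rewrite distrC|rewrite subrr normr0].
- move=> x y xab ycd; have [[al be] H] := Cdiff_expansion (dG x y xab ycd).
  exists al, be => e e0; have [r r0 {}H] := H e e0.
  exists (r / 2); first by rewrite divr_gt0.
  move=> x' y' xx' yy'; set h := (x' - x) +i* (y' - y).
  have hn : normc h <= `|x' - x| + `|y' - y| := normc_le_ReIm h.
  have hr : normc h < r by lra.
  have {H} := H h hr.
  have -> : x +i* y + h = x' +i* y' by rewrite /h; simpc; rewrite ![_ + (_ - _)]addrC !subrK.
  move=> H; have {hn} : e * normc h <= e * (`|x' - x| + `|y' - y|) by rewrite ler_pM2l.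
  move=> /(le_trans H) {}H.
  have := le_trans (Re_normc _) H; have := le_trans (Im_normc _) H.
  move: (G _) (G _) => [u v] [u' v'] /= hI hR.
  by split => //; rewrite (addrC (be * _)).
Qed.

End ComplexExp.

(** * The mean value property *)

Section MeanValue.
Import Normc.
Local Open Scope complex_scope.
Context {R : realType}.
Implicit Types (z w h : R[i]) (F G : R[i] -> R[i]).

Lemma normc_polar (r t : R) : 0 <= r -> normc (polar r t) = r.
Proof.
move=> r0; rewrite /polar /= !exprMn -mulrDr cos2Dsin2 mulr1 sqrtr_sqr.
by rewrite ger0_norm.
Qed.

(** The points at which circle means are compared, on a logarithmic scale of
    radii: [x1] gives a circle close to the centre, [x2] and [x3] enclose the
    exceptional circle of radius [s]. *)
Lemma points_around_log (s d d' : R) : 0 < s -> s < 1 -> 0 < d -> 0 < d' ->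
  exists xs x1 x2 x3, [/\ expR xs = s, x1 <= x2, x2 < xs < x3 & x3 <= 0] /\
    [/\ `|x2 - xs| < d, `|x3 - xs| < d & expR x1 < d'].
Proof.
move=> s0 s1 d0 d'0; exists (ln s).
have xs0 : ln s < 0 by rewrite ln_lt0// s0.
exists (Num.min (ln s - d / 2) (ln (d' / 2))), (ln s - d / 2).
exists (Num.min 0 (ln s + d / 2)).
have d2 : 0 < d' / 2 by rewrite divr_gt0.
have x3 : ln s < Num.min 0 (ln s + d / 2) by rewrite lt_min xs0; lra.
split; split.
- by rewrite lnK.
- by rewrite ge_min lexx.
- by rewrite x3 andbT; lra.
- by rewrite ge_min lexx.
- by rewrite addrAC subrr add0r normrN gtr0_norm; lra.
- have : Num.min 0 (ln s + d / 2) <= ln s + d / 2 by rewrite ge_min lexx orbT.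
  by rewrite gtr0_norm; lra.
- apply: (@le_lt_trans _ _ (d' / 2)); last lra.
  by rewrite -[leRHS]lnK// ler_expR ge_min lexx orbT.
Qed.

Lemma dist_le_thirds (a b c k e : R) : `|a - k| <= e / 3 -> `|a - b| <= e / 3 ->
  `|c - b| <= e / 3 -> `|c - k| <= e.
Proof. by rewrite !ler_norml; lra. Qed.

Lemma Ccont_comp F G z : Ccont G z -> Ccont F (G z) -> Ccont (F \o G) z.
Proof. exact: continuous_comp. Qed.

(** On the circle of radius [s] the function is only assumed continuous: this is
    what allows a removable singularity at a point of that circle. *)
Variables (F : R[i] -> R[i]) (s : R).
Hypotheses (s0 : 0 < s) (s1 : s < 1).
Hypothesis dF : forall w, normc w <= 1 -> normc w <> s -> Cdiff F w.
Hypothesis cF : forall w, normc w <= 1 -> Ccont F w.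

Let g x y := complex.Re (F (polar (expR x) y)).
Let M x := segint 0 (2 * pi) (g x).

Let exp_le1 (x : R) : x <= 0 -> expR x <= 1.
Proof. by rewrite -(@expR0 R) ler_expR. Qed.

Let cFE (x y : R) : x <= 0 -> Ccont (F \o cexp) (x +i* y).
Proof.
move=> x0; apply: Ccont_comp; first exact/Cdiff_cont/Cdiff_cexp.
by apply: cF; rewrite normc_cexp exp_le1.
Qed.

Let g_joint (x y : R) : x <= 0 -> forall e : R, 0 < e ->
  exists2 d : R, 0 < d & forall x' y', `|x' - x| < d -> `|y' - y| < d ->
    `|g x' y' - g x y| < e.
Proof.
move=> x0 e e0; have [d d0 H] := Ccont_joint (@cFE x y x0) e0.
by exists d => // x' y' xx yy; apply: normc_Re_lt; exact: H.
Qed.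

Let cg (x : R) : x <= 0 -> continuous_on 0 (2 * pi) (g x).
Proof.
move=> x0 y _; apply/cvgrPdist_lt => e e0; have [d d0 H] := g_joint y x0 e0.
exists d => // y'; rewrite /ball_/= => yy; rewrite distrC.
by apply: H; rewrite ?subrr ?normr0// distrC.
Qed.

Let twopi_ge0 : (0 : R) <= 2 * pi.
Proof. by rewrite mulr_ge0// pi_ge0. Qed.

Let M_near_cst x (k e : R) : x <= 0 -> (forall y, `|g x y - k| <= e) ->
  `|M x - k * (2 * pi)| <= e * (2 * pi).
Proof.
move=> x0 H; have := @segint_near_cst R 0 (2 * pi) k e (g x) twopi_ge0 (cg x0).
by rewrite subr0; apply=> y _; exact: H.
Qed.

(** The segment of integration is compact, so continuity in [x] is uniform in
    [y]. *)
Let M_cont x : x < 0 -> forall e, 0 < e -> exists2 d, 0 < d &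
  forall x', x' <= 0 -> `|x' - x| < d -> `|M x' - M x| <= e * (2 * pi).
Proof.
move=> x0 e e0.
have /compact_near_coveringP/(_ R (nbhs x) (fun x' y => `|g x' y - g x y| < e)) :
  compact `[(0 : R), 2 * pi] by exact: segment_compact.
case.
  move=> y _; have [d d0 H] := g_joint y (ltW x0) (divr_gt0 e0 (ltr0Sn R 1)).
  exists (ball y d, ball x d); first by split; exact: nbhsx_ballx.
  move=> [y' x'] /= [yy xx].
  have h1 : `|g x' y' - g x y| < e / 2 by apply: H; rewrite distrC.
  have h2 : `|g x y' - g x y| < e / 2.
    by apply: H; [rewrite subrr normr0|rewrite distrC].
  rewrite (_ : g x' y' - g x y' = (g x' y' - g x y) - (g x y' - g x y)); last by ring.
  by apply: le_lt_trans (ler_normB _ _) _; lra.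
move=> d /= d0 H; exists d => // x' x'0 xx.
rewrite /M -segintB; [|exact: cg|exact/cg/ltW].
have cgg := continuous_onB (cg x'0) (cg (ltW x0)).
have := @segint_near_cst R 0 (2 * pi) 0 e _ twopi_ge0 cgg.
rewrite mul0r !subr0; apply=> y y01; rewrite subr0 ltW//; apply: (H x') => //=.
by rewrite /ball_ /= distrC.
Qed.

(** The horizontal sides of the rectangle cancel by periodicity of the
    exponential. *)
Let M_cst a b : a <= b -> b <= 0 -> (forall x, a <= x <= b -> expR x <> s) ->
  M a = M b.
Proof.
move=> ab b0 H.
have dFE x y : a <= x <= b -> 0 <= y <= 2 * pi -> Cdiff (F \o cexp) (x +i* y).
  move=> xab _; apply: Cdiff_comp; first exact: Cdiff_cexp.
  apply: dF; rewrite normc_cexp/=; last exact: H.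
  by apply: exp_le1; case/andP: xab => _ /le_trans; exact.
have := goursat_Cdiff ab twopi_ge0 dFE.
rewrite segintB; [|exact: cg|exact: (cg (le_trans ab b0))].
have -> : segint a b (fun x => complex.Im ((F \o cexp) (x +i* (2 * pi))) -
    complex.Im ((F \o cexp) (x +i* 0))) = segint a b (fun=> 0).
  apply: eq_segint => x _ /=; rewrite /cexp /polar /=.
  by rewrite mulr_natl cos2pi sin2pi cos0 sin0 subrr.
rewrite (segint_cst 0 ab) mul0r => /eqP; rewrite subr_eq0 => /eqP/esym MM.
exact: MM.
Qed.

(** The mean [M] is constant on each side of the exceptional radius, continuous
    at that radius, and tends to the value at 0 as the radius shrinks. *)
Lemma mean_value :
  segint 0 (2 * pi) (fun t => complex.Re (F (polar 1 t))) =
  complex.Re (F 0) * (2 * pi).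
Proof.
have M0 : segint 0 (2 * pi) (fun t => complex.Re (F (polar 1 t))) = M 0.
  by rewrite /M /g expR0.
rewrite M0.
apply/eqP; rewrite -subr_eq0 -normr_eq0 eq_le normr_ge0 andbT.
have pi2 : (0 : R) < 2 * pi by rewrite mulr_gt0// pi_gt0.
apply/ler_addgt0Pl => e e0; rewrite addr0.
have e1 : 0 < e / 3 / (2 * pi) by rewrite !divr_gt0.
have xs0 : ln s < 0 by rewrite ln_lt0// s0.
have [d d0 Hd] := M_cont xs0 e1.
have c0 : Ccont F 0 by apply: cF; rewrite normc0.
have [d' d'0 Hd'] := Ccont_eps c0 e1.
(* The three errors below add up to at most [e]. *)
have [xs [x1 [x2 [x3 [[xsE x12 /andP[x2s xs3] x30] [x2d x3d ex1]]]]]] :=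
  points_around_log s0 s1 d0 d'0.
rewrite -xsE expRK in xs0 Hd.
have h1 : `|M x1 - complex.Re (F 0) * (2 * pi)| <= e / 3 / (2 * pi) * (2 * pi).
  apply: M_near_cst; first exact: le_trans x12 (ltW (lt_trans x2s xs0)).
  move=> y; apply/ltW/normc_Re_lt/Hd'.
  by rewrite subr0 normc_polar ?expR_ge0.
have M12 : M x1 = M x2.
  apply: M_cst => //; first exact/ltW/(lt_trans x2s).
  move=> x /andP[_ xx2]; rewrite -xsE => /expR_inj xxs.
  by move: xx2; rewrite xxs leNgt x2s.
have M30 : M x3 = M 0.
  apply: M_cst => // x /andP[xx3 _]; rewrite -xsE => /expR_inj xxs.
  by move: xx3; rewrite xxs leNgt xs3.
have h2 := Hd _ (ltW (lt_trans x2s xs0)) x2d.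
have h3 := Hd _ x30 x3d.
move: h1 h2 h3; rewrite -M30 -M12 divfK; last exact: lt0r_neq0.
exact: dist_le_thirds.
Qed.

End MeanValue.

(** * Removable singularities and the Poisson kernel *)

Section Slope.
Import Normc.
Local Open Scope complex_scope.
Context {R : realType}.
Implicit Types (z w h : R[i]) (F G K : R[i] -> R[i]).

Lemma continuous_on_circle F (a b : R) : (forall w, normc w <= 1 -> Ccont F w) ->
  continuous_on a b (fun t => complex.Re (F (polar 1 t))).
Proof.
move=> cF t _; apply/cvgrPdist_lt => e e0.
have cFE : Ccont (F \o cexp) (0 +i* t).
  apply: Ccont_comp; first exact/Cdiff_cont/Cdiff_cexp.
  by apply: cF; rewrite normc_cexp /= expR0.
have [d d0 H] := Ccont_joint cFE e0.
exists d => // t'; rewrite /ball_/= distrC => tt; rewrite distrC.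
have := H 0 t'; rewrite subrr normr0 => /(_ d0 tt) /normc_Re_lt.
by rewrite /= /cexp /= expR0.
Qed.

Lemma Cdiff_cst (c : R[i]) z : Cdiff (fun=> c) z.
Proof. exact: derivable_cst. Qed.

Lemma Cdiff_id z : Cdiff id z.
Proof. exact: derivable_id. Qed.

Lemma CdiffD F G z : Cdiff F z -> Cdiff G z -> Cdiff (fun w => F w + G w) z.
Proof. exact: derivableD. Qed.

Lemma CdiffB F G z : Cdiff F z -> Cdiff G z -> Cdiff (fun w => F w - G w) z.
Proof. exact: derivableB. Qed.

Lemma CdiffM F G z : Cdiff F z -> Cdiff G z -> Cdiff (fun w => F w * G w) z.
Proof. exact: derivableM. Qed.

Lemma CdiffV F z : F z != 0 -> Cdiff F z -> Cdiff (fun w => (F w)^-1) z.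
Proof. exact: derivableV. Qed.

Lemma CcontM F G z : Ccont F z -> Ccont G z -> Ccont (fun w => F w * G w) z.
Proof. exact: (@continuousM R[i] R[i]^o). Qed.

Lemma eps_Ccont G z : (forall e : R, 0 < e ->
  exists2 d : R, 0 < d & forall w, normc (w - z) < d -> normc (G w - G z) < e) ->
  Ccont G z.
Proof.
move=> H; apply/(@cvgrPdist_lt _ _ _ (nbhs (z : R[i]^o)) (nbhs_filter (z : R[i]^o))).
move=> -[e1 e2] /=.
rewrite ltcE/= => /andP[/eqP -> e0]; have [d d0 {}H] := H _ e0.
exists (d%:C); first by rewrite /= ltcR.
move=> w; rewrite /ball_ /= distrC normE ltcR => /H.
by rewrite distrC normE ltcR.
Qed.

(** With the derivative of [K] at [a] for [D], the singularity at [a] is removed. *)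
Definition slope K (D a w : R[i]) : R[i] :=
  if w == a then D else (K w - K a) / (w - a).

Lemma Cdiff_slope K D a w : w != a -> Cdiff K w -> Cdiff (slope K D a) w.
Proof.
move=> wa dK.
apply: (@near_eq_derivable _ R[i]^o R[i]^o (fun w => (K w - K a) * (w - a)^-1)).
- have : 0 < `|w - a| by rewrite normr_gt0 subr_eq0.
  move=> d0; exists `|w - a| => // v; rewrite /ball_ /= => vw.
  rewrite /slope ifN//; apply/eqP => va; by rewrite va ltxx in vw.
- apply: (@CdiffM (fun w => K w - K a) (fun w => (w - a)^-1)).
    exact: (@CdiffB K (fun=> K a) w dK (@Cdiff_cst (K a) w)).
  apply: CdiffV; first by rewrite subr_eq0.
  by apply: CdiffB; [exact: Cdiff_id|exact: Cdiff_cst].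
Qed.

Lemma Ccont_slope K a : Cdiff K a -> exists D, Ccont (slope K D a) a.
Proof.
move=> /Cdiff_expansion[D H]; exists D; apply: eps_Ccont => e e0.
have [d d0 {}H] := H (e / 2) (divr_gt0 e0 (ltr0Sn R 1)).
exists d => // w wd; rewrite /slope eqxx; case: eqVneq => [_|wa].
  by rewrite subrr normc0.
have := H (w - a) wd; rewrite [a + _]addrC subrK => {}H.
have n0 : 0 < normc (w - a) by rewrite normc_gt0 subr_eq0.
rewrite -(ltr_pM2r n0) -normcM mulrBl divfK ?subr_eq0//.
by apply: le_lt_trans H _; rewrite ltr_pM2r//; lra.
Qed.
End Slope.

Section PoissonKernel.
Import Normc.
Local Open Scope complex_scope.
Context {R : realType}.
Variable s : R.
Hypotheses (s0 : 0 < s) (s1 : s < 1).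

(** The Poisson kernel of the point [s] of the real axis at the boundary point
    [e^(i t)]. *)
Definition poisson (t : R) := (1 - s ^+ 2) / (1 - 2 * s * cos t + s ^+ 2).

Lemma poisson_den_gt0 t : 0 < 1 - 2 * s * cos t + s ^+ 2.
Proof.
have := cos_le1 t => c1.
have : s * cos t <= s by rewrite ler_piMr// ltW.
have : 0 < (1 - s) ^+ 2 by rewrite exprn_gt0// subr_gt0.
rewrite !expr2; lra.
Qed.

Lemma poisson_le t : poisson t <= (1 + s) / (1 - s).
Proof.
rewrite /poisson ler_pdivrMr ?poisson_den_gt0// mulrAC ler_pdivlMr ?subr_gt0//.
have := cos_le1 t => c1.
have : s * cos t <= s by rewrite ler_piMr// ltW.
move=> h; have s1' : 0 <= 1 + s by rewrite addr_ge0// ltW.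
have : (1 + s) * (s * cos t) <= (1 + s) * s by exact: ler_wpM2l.
rewrite !expr2; lra.
Qed.

Lemma pole_factor_neq0 w : normc w <= 1 -> 1 - s%:C * w != 0.
Proof.
move=> w1; rewrite subr_eq0; apply/eqP => /(congr1 (@normc R)).
rewrite normc1 normcM /= expr0n addr0 sqrtr_sqr gtr0_norm// => h.
have : s * normc w <= s by rewrite ler_piMr// ltW.
by rewrite -h leNgt s1.
Qed.

Lemma Cdiff_pole_factor w : normc w <= 1 -> Cdiff (fun w => (1 - s%:C * w)^-1) w.
Proof.
move=> w1; apply: CdiffV; first exact: pole_factor_neq0.
apply: CdiffB; first exact: Cdiff_cst.
by apply: CdiffM; [exact: Cdiff_cst|exact: Cdiff_id].
Qed.

(** The holomorphic function whose real part on the unit circle is the Poisson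
    kernel; its value 1 at 0 normalises the kernel. *)
Definition herglotz w := (1 + s%:C * w) * (1 - s%:C * w)^-1.

Lemma Cdiff_herglotz w : normc w <= 1 -> Cdiff herglotz w.
Proof.
move=> w1; apply: CdiffM; last exact: Cdiff_pole_factor.
apply: CdiffD; first exact: Cdiff_cst.
by apply: CdiffM; [exact: Cdiff_cst|exact: Cdiff_id].
Qed.

Lemma sin2E (t : R) : sin t ^+ 2 = 1 - cos t ^+ 2.
Proof. by rewrite -(cos2Dsin2 t); ring. Qed.

(** After multiplication by the denominator the real part becomes a polynomial
    identity modulo [sin^2 = 1 - cos^2]. *)
Lemma Re_herglotz t : complex.Re (herglotz (polar 1 t)) = poisson t.
Proof.
have n1 : normc (polar 1 t) <= 1 by rewrite normc_polar.
suff : herglotz (polar 1 t) =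
    poisson t +i* (2 * s * sin t / (1 - 2 * s * cos t + s ^+ 2)).
  by move=> ->.
apply: (mulIf (pole_factor_neq0 n1)); rewrite /herglotz mulfVK ?pole_factor_neq0//.
have -> : 1 + s%:C * polar 1 t = (1 + s * cos t) +i* (s * sin t).
  by rewrite /polar !mul1r; simpc.
have -> : 1 - s%:C * polar 1 t = (1 - s * cos t) +i* (- (s * sin t)).
  by rewrite /polar !mul1r; simpc.
rewrite /poisson; simpc.
have D0 := lt0r_neq0 (poisson_den_gt0 t).
congr (_ +i* _); last by field.
apply: (mulIf D0); rewrite [RHS]mulrDl.
have -> : (1 - s ^+ 2) / (1 - 2 * s * cos t + s ^+ 2) * (1 - s * cos t) *
  (1 - 2 * s * cos t + s ^+ 2) = (1 - s ^+ 2) * (1 - s * cos t) by field.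
have -> : 2 * s * sin t / (1 - 2 * s * cos t + s ^+ 2) * (s * sin t) *
  (1 - 2 * s * cos t + s ^+ 2) = 2 * s ^+ 2 * sin t ^+ 2 by field.
by rewrite sin2E; ring.
Qed.

End PoissonKernel.

(** * The Poisson formula and Harnack's inequality *)

Section Harnack.
Import Normc.
Local Open Scope complex_scope.
Context {R : realType}.
Implicit Types (z w h : R[i]) (F G K f : R[i] -> R[i]).

Lemma normc_real (r : R) : 0 <= r -> normc (r%:C) = r.
Proof. by move=> r0; rewrite /= expr0n addr0 sqrtr_sqr ger0_norm. Qed.

(** On the unit circle [1 - s w = w (conj w - s)] for real [s], which explains why
    [w / ((w - s) (1 - s w))] is real there. *)
Lemma poisson_kernelE (s t : R) :
  (polar 1 t - s%:C) * (1 - s%:C * polar 1 t) =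
  (1 - 2 * s * cos t + s ^+ 2)%:C * polar 1 t.
Proof.
rewrite /polar !mul1r; simpc; have := sin2E t.
move: (cos t) (sin t) => c S E; congr (_ +i* _).
  transitivity (c * (1 - s * c) - s + s ^+ 2 * c + s * S ^+ 2); [ring|rewrite E; ring].
by ring.
Qed.

(** Without exceptional circle; the radius 1/2 is an arbitrary choice. *)
Lemma mean_value_Cdiff F : (forall w, normc w <= 1 -> Cdiff F w) ->
  segint 0 (2 * pi) (fun t => complex.Re (F (polar 1 t))) =
  complex.Re (F 0) * (2 * pi).
Proof.
move=> dF; apply: (@mean_value _ F (1 / 2)); [lra|lra| |].
  by move=> w w1 _; exact: dF.
by move=> w w1; exact/Cdiff_cont/dF.
Qed.

Lemma slope_circle K D (s t : R) : 0 < s -> s < 1 ->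
  complex.Re (slope K D s%:C (polar 1 t) *
    (polar 1 t * (1 - s ^+ 2)%:C * (1 - s%:C * polar 1 t)^-1)) =
  complex.Re (K (polar 1 t)) * poisson s t - complex.Re (K s%:C) * poisson s t.
Proof.
move=> s0 s1.
have n1 : normc (polar 1 t : R[i]) = 1 by rewrite normc_polar.
have D0 := lt0r_neq0 (poisson_den_gt0 s0 s1 t).
have DC0 : (1 - 2 * s * cos t + s ^+ 2)%:C != 0 :> R[i].
  by apply: contra D0 => /eqP [->].
have wz : polar 1 t != 0 :> R[i] by rewrite -normc_gt0 n1.
have ws : polar 1 t != s%:C :> R[i].
  apply/eqP => /(congr1 (@normc R)); rewrite n1 normc_real ?(ltW s0)// => H.
  by move: s1; rewrite -H ltxx.
have wd : 1 - s%:C * polar 1 t != 0 by apply: pole_factor_neq0 => //; rewrite n1.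
have kE := poisson_kernelE s t.
have -> : slope K D s%:C (polar 1 t) *
    (polar 1 t * (1 - s ^+ 2)%:C * (1 - s%:C * polar 1 t)^-1) =
    (K (polar 1 t) - K s%:C) * (poisson s t)%:C.
  have ws0 : polar 1 t - s%:C != 0 by rewrite subr_eq0.
  have -> : (poisson s t)%:C =
      (1 - s ^+ 2)%:C / (1 - 2 * s * cos t + s ^+ 2)%:C.
    by rewrite /poisson rmorphM/= fmorphV.
  rewrite /slope (negbTE ws).
  move: kE ws0 wd wz DC0; move: (polar 1 t) (_ - s%:C) (1 - _ * _) (K _ - K _).
  move=> w a b k; move: (_%:C) (_%:C) => d e kE a0 b0 w0 d0.
  apply: (mulIf d0); rewrite -[RHS]mulrA divfK//.
  apply: (mulIf b0); apply: (mulIf a0).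
  have -> : k / a * (w * d / b) * e * b * a = k * d * (e * w) by field; rewrite a0 b0.
  by rewrite -kE; ring.
case: (K _) => u v; case: (K _) => u' v'; simpc => /=; ring.
Qed.

(** The mean value property for [(K w - K s) (1 - s^2) w / ((w - s) (1 - s w))],
    whose singularity at [s] is removable, whose value at 0 is 0, and whose real
    part on the circle is given by [slope_circle]. *)
Lemma poisson_formula K (s : R) : 0 < s -> s < 1 ->
  (forall w, normc w <= 1 -> Cdiff K w) ->
  segint 0 (2 * pi) (fun t => complex.Re (K (polar 1 t)) * poisson s t) =
  complex.Re (K s%:C) * (2 * pi).
Proof.
move=> s0 s1 dK.
have sn : normc (s%:C) = s by rewrite normc_real// ltW.
have s1' : normc (s%:C) <= 1 by rewrite sn ltW.
have [D cD] := Ccont_slope (dK _ s1').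
pose E w := w * (1 - s ^+ 2)%:C * (1 - s%:C * w)^-1.
have dE w : normc w <= 1 -> Cdiff E w.
  move=> w1; apply: CdiffM; last exact: Cdiff_pole_factor.
  by apply: CdiffM; [exact: Cdiff_id|exact: Cdiff_cst].
pose F w := slope K D s%:C w * E w.
have dF w : normc w <= 1 -> w != s%:C -> Cdiff F w.
  by move=> w1 ws; apply: CdiffM; [exact: Cdiff_slope (dK _ w1)|exact: dE].
have cF w : normc w <= 1 -> Ccont F w.
  move=> w1; have [->|ws] := eqVneq w s%:C.
    by apply: CcontM; [exact: cD|exact/Cdiff_cont/dE].
  exact/Cdiff_cont/dF.
have dF' w : normc w <= 1 -> normc w <> s -> Cdiff F w.
  by move=> w1 ws; apply: dF => //; apply/eqP => wE; apply: ws; rewrite wE.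
have := mean_value s0 s1 dF' cF; rewrite {2}/F /E !mul0r mulr0 mul0r => F0.
have cK := @continuous_on_circle R _ 0 (2 * pi) (fun w n1 => Cdiff_cont (dK w n1)).
have dH w (w1 : normc w <= 1) := Cdiff_herglotz s0 s1 w1.
have cP : continuous_on 0 (2 * pi) (poisson s).
  have := @continuous_on_circle R _ 0 (2 * pi) (fun w n1 => Cdiff_cont (dH w n1)).
  by under eq_fun do rewrite (Re_herglotz s0 s1).
have P1 : segint 0 (2 * pi) (poisson s) = 2 * pi.
  have := mean_value_Cdiff dH; under eq_segint do rewrite (Re_herglotz s0 s1).
  by rewrite /herglotz mulr0 addr0 subr0 invr1 mulr1 mul1r.
have cKP : continuous_on 0 (2 * pi) (fun t => complex.Re (K (polar 1 t)) * poisson s t).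
  by move=> t tt; apply: continuousM; [exact: cK|exact: cP].
(* The mean of [F] is 0 = F 0, that of the kernel is 1. *)
move: F0; under eq_segint do rewrite /F /E (slope_circle K D _ s0 s1).
rewrite (segintB cKP (continuous_onZ cP)) segintZ// P1.
by move/eqP; rewrite subr_eq0 => /eqP.
Qed.

Theorem harnack K (s : R) : 0 < s -> s < 1 ->
  (forall w, normc w <= 1 -> Cdiff K w) ->
  (forall t : R, 0 <= complex.Re (K (polar 1 t))) ->
  complex.Re (K s%:C) <= (1 + s) / (1 - s) * complex.Re (K 0).
Proof.
move=> s0 s1 dK K0.
have pi2 : (0 : R) < 2 * pi by rewrite mulr_gt0// pi_gt0.
have cK := @continuous_on_circle R _ 0 (2 * pi) (fun w n1 => Cdiff_cont (dK w n1)).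
rewrite -(ler_pM2r pi2) -[leRHS]mulrA -(mean_value_Cdiff dK) -(poisson_formula s0 s1 dK).
rewrite -segintZ//; apply: le_segint; last 1 first.
- by move=> t _; rewrite mulrC ler_wpM2r// (poisson_le s0 s1).
- move=> t tt; apply: continuousM; first exact: cK.
  have dH w (w1 : normc w <= 1) := Cdiff_herglotz s0 s1 w1.
  have := @continuous_on_circle R _ 0 (2 * pi) (fun w n1 => Cdiff_cont (dH w n1)).
  by under eq_fun do rewrite (Re_herglotz s0 s1); exact.
- exact: continuous_onZ.
Qed.

(** Harnack's inequality for [M - Re f], transported by the affine map
    [w |-> c + a w].  A complex [a] covers rotations, so that the point of
    comparison can be taken on the positive real axis. *)
Theorem harnack_disc f c a (M s : R) : 0 < s -> s < 1 ->
  (forall z, normc z < 1 -> Cdiff f z) -> normc c + normc a < 1 ->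
  (forall t : R, complex.Re (f (c + a * polar 1 t)) <= M) ->
  M - complex.Re (f (c + a * s%:C)) <=
  (1 + s) / (1 - s) * (M - complex.Re (f c)).
Proof.
move=> s0 s1 df ca fM; pose K w := M%:C - f (c + a * w).
have dK w : normc w <= 1 -> Cdiff K w.
  move=> w1; apply: (@CdiffB _ (fun=> M%:C) (fun w => f (c + a * w))).
    exact: Cdiff_cst.
  apply: (@Cdiff_comp _ f (fun w => c + a * w)).
    apply: (@CdiffD _ (fun=> c) (fun w => a * w)); first exact: Cdiff_cst.
    by apply: (@CdiffM _ (fun=> a) id); [exact: Cdiff_cst|exact: Cdiff_id].
  apply: df; apply: le_lt_trans (le_normcD _ _) _; apply: le_lt_trans ca.
  by rewrite lerD2l normcM ler_piMr// normc_ge0.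
have K0 t : 0 <= complex.Re (K (polar 1 t)).
  have := fM t; rewrite /K; case: (f _) => u v /=; by rewrite subr_ge0.
have := harnack s0 s1 dK K0; rewrite /K mulr0 addr0.
by case: (f _) => u v; case: (f _) => u' v'.
Qed.

End Harnack.

(** * From upper bounds to lower bounds *)

Section LowerBound.
Import Normc.
Local Open Scope complex_scope.
Context {R : realType}.
Implicit Types (z w : R[i]).

Lemma polar1E (r t : R) : polar r t = r%:C * polar 1 t.
Proof. by rewrite /polar !mul1r; simpc. Qed.

Lemma normc_scaled_polar (r t : R) : 0 <= r -> normc (r%:C * polar 1 t) = r.
Proof. by move=> r0; rewrite -polar1E normc_polar. Qed.

Lemma normc_ge_diff z w : normc z - normc w <= normc (z + w).
Proof.
by rewrite lerBlDr; have := le_normcD (z + w) (- w); rewrite addrK normcN.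
Qed.

(** The bound is expressed in terms of the distance [x = 1 - |z|] to the unit
    circle: [Phi x] stands for [V (1 / x)], and the monotonicity of [V t / t]
    becomes that of [x * Phi x]. *)
Variables (f : R[i] -> R[i]) (Phi : R -> R) (R0 N : R).
Hypothesis df : forall z, normc z < 1 -> Cdiff f z.
Hypothesis f0 : f 0 = 0.
Hypotheses (R0gt0 : 0 < R0) (R0le1 : R0 <= 1) (N2 : 2 <= N).
Hypothesis fPhi : forall z, 1 - R0 < normc z -> normc z < 1 ->
  complex.Re (f z) <= Phi (1 - normc z).
Hypothesis Phi_ge0 : forall x, 0 < x -> x < R0 -> 0 <= Phi x.
Hypothesis Phi_mono : forall x y, 0 < x -> x <= y -> y < R0 ->
  y * Phi y <= x * Phi x.

Notation u r t := (complex.Re (f (polar r t))).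
Notation R1 := (R0 / 2).

Let Phi_nincr x y : 0 < x -> x <= y -> y < R0 -> Phi y <= Phi x.
Proof.
move=> x0 xy yR; have y0 := lt_le_trans x0 xy.
rewrite -(ler_pM2l y0); apply: le_trans (Phi_mono x0 xy yR) _.
by apply: ler_wpM2r => //; apply: Phi_ge0 => //; exact: le_lt_trans xy yR.
Qed.

(** The disc has centre [(1 - N d) e^(i t)] and radius [r = (N - 1/2) d]; the point
    at distance [d] from the unit circle corresponds to the parameter
    [s = (N - 1) / (N - 1/2)], for which the Harnack constant is [4 N - 3]. *)
Lemma harnack_step d t : 0 < d -> N * d <= R1 ->
  - u (1 - d) t <= 4 * N * (Phi (d / 2) + Num.max 0 (- u (1 - N * d) t)).
Proof.
move=> d0 Nd.
have [hN hR hR0] := And3 N2 R0le1 R0gt0.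
have N0 : 0 < N by lra.
have Nd2 : 2 * d <= N * d by rewrite ler_pM2r.
have dR : d / 2 < R0 by lra.
have d20 : 0 < d / 2 by rewrite divr_gt0.
pose r := (N - 1 / 2) * d.
have rE : r = N * d - d / 2 by rewrite /r; ring.
pose s := (N - 1) / (N - 1 / 2).
have s0 : 0 < s by rewrite /s divr_gt0//; lra.
have s1 : s < 1 by rewrite /s ltr_pdivrMr ?mul1r; lra.
have c0 : 0 <= 1 - N * d by lra.
have r0 : 0 <= r by rewrite rE; lra.
have nc := normc_scaled_polar t c0; have na := normc_scaled_polar t r0.
have fM t' : complex.Re (f ((1 - N * d)%:C * polar 1 t + (r%:C * polar 1 t) * polar 1 t'))
    <= Phi (d / 2).
  set z := (1 - N * d)%:C * _ + _.
  have na' : normc (r%:C * polar 1 t * polar 1 t') = r.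
    by rewrite normcM na normc_polar// mulr1.
  have zu : normc z <= 1 - d / 2.
    by apply: le_trans (le_normcD _ _) _; rewrite nc na' rE; lra.
  have zl : 1 - 2 * (N * d) + d / 2 <= normc z.
    by apply: le_trans (normc_ge_diff _ _); rewrite nc na' rE; lra.
  apply: le_trans (fPhi _ _) _; [lra|lra|].
  by apply: Phi_nincr => //; lra.
have := harnack_disc s0 s1 df _ fM; rewrite nc na.
have -> : (1 - N * d)%:C * polar 1 t + r%:C * polar 1 t * s%:C = polar (1 - d) t.
  rewrite [RHS]polar1E mulrAC -mulrDl -rmorphM -rmorphD/=; congr (_%:C * _).
  by rewrite /r /s; field; lra.
have rc : 1 - N * d + r < 1 by rewrite rE; lra.
rewrite -polar1E => /(_ rc).
have -> : (1 + s) / (1 - s) = 4 * N - 3.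
  by rewrite /s; field; apply/andP; split; lra.
have P0 : 0 <= Phi (d / 2) by apply: Phi_ge0.
set m := Num.max _ _; set U := complex.Re _; set V := complex.Re _.
move: P0; set P := Phi _ => P0 H.
have m0 : 0 <= m by rewrite /m le_max lexx.
have mV : - V <= m by rewrite /m le_max lexx orbT.
(* The constant [4 N - 3] is replaced by [4 N] only once its factor is known to
   be nonnegative, which is why [V] is first replaced by its negative part. *)
have : (4 * N - 3) * (P - V) <= (4 * N - 3) * (P + m).
  by apply: ler_wpM2l; lra.
by nra.
Qed.

Let A := 4 * N / R1 * Phi (R1 / (2 * N)).

(** For [d] between [R1 / N] and [R1] a single disc centred at 0 suffices.  Its
    radius [1 - R1 / (2 N)] leaves a margin at least [R1 / (2 N)] beyond the point,
    which bounds the Harnack constant independently of [d]. *)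
Lemma harnack_base d t : R1 < N * d -> d <= R1 -> - u (1 - d) t <= A.
Proof.
move=> dl du.
have [hN hR hR0] := And3 N2 R0le1 R0gt0.
have N0 : 0 < N by lra.
have d0 : 0 < d by rewrite -(pmulr_rgt0 d N0); lra.
pose q := R1 / (2 * N).
have q0 : 0 < q by rewrite /q !divr_gt0// mulr_gt0.
have qd : q < d / 2.
  rewrite /q ltr_pdivrMr ?mulr_gt0//; lra.
pose s := (1 - d) / (1 - q).
have s0 : 0 < s by rewrite /s divr_gt0//; lra.
have s1 : s < 1 by rewrite /s ltr_pdivrMr ?mul1r; lra.
have q1 : 0 <= 1 - q by lra.
have fM t' : complex.Re (f (0 + ((1 - q)%:C * polar 1 t) * polar 1 t')) <= Phi q.
  set z := 0 + _.
  have nz : normc z = 1 - q.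
    by rewrite /z add0r normcM normc_scaled_polar// normc_polar// mulr1.
  have := fPhi (z := z); rewrite nz subKr; apply; lra.
have := harnack_disc s0 s1 df _ fM.
have q1' : 1 - q < 1 by lra.
rewrite normc0 add0r normc_scaled_polar// => /(_ q1').
have -> : 0 + (1 - q)%:C * polar 1 t * s%:C = polar (1 - d) t.
  rewrite add0r [RHS]polar1E mulrAC -rmorphM/=; congr (_%:C * _).
  by rewrite /s; field; lra.
rewrite f0 subr0 => H.
have P0 : 0 <= Phi q by apply: Phi_ge0 => //; lra.
have sq : (1 + s) / (1 - s) <= 2 / q.
  rewrite ler_pdivrMr ?subr_gt0// mulrAC ler_pdivlMr//.
  have : q * (1 - q) <= (1 - s) * (1 - q).
    rewrite [leRHS]mulrBl mul1r /s divfK; first nra.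
    by rewrite gt_eqF//; lra.
  rewrite ler_pM2r; last lra.
  move=> qs; have : (1 + s) * q <= 2 * q by rewrite ler_pM2r//; lra.
  lra.
have AE : A = 2 / q * Phi q.
  by rewrite /A /q; congr (_ * _); field; rewrite !gt_eqF.
rewrite AE; apply: le_trans (_ : Phi q - u (1 - d) t <= _); first by lra.
apply: le_trans H _; exact: ler_wpM2r.
Qed.

(** Multiplying [harnack_step] by [d] gives [y d <= W d + 4 * y (N d)] where
    [y d] is [d] times the negative part of [u] and [W d = 4 N d Phi (d / 2)] does
    not increase with [d]; the factor [5 ^ k] absorbs both the repeated factor 4
    and the sum of the terms [W]. *)
Lemma lower_bound_iter k d t : 0 < d -> R1 < N ^+ k.+1 * d -> N ^+ k * d <= R1 ->
  d * - u (1 - d) t <= 5 ^+ k * (4 * N * d * Phi (d / 2) + A).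
Proof.
have [hN hR hR0] := And3 N2 R0le1 R0gt0.
have N0 : 0 < N by lra.
have A0 : 0 <= A.
  rewrite /A mulr_ge0//; first by rewrite divr_ge0//; lra.
  apply: Phi_ge0; first by rewrite !divr_gt0// mulr_gt0.
  by rewrite ltr_pdivrMr ?mulr_gt0//; nra.
have W0 x : 0 < x -> x <= R1 -> 0 <= 4 * N * x * Phi (x / 2).
  move=> x0 xR; apply: mulr_ge0; first by rewrite !mulr_ge0// ltW.
  by apply: Phi_ge0; lra.
elim: k d => [|k IH] d d0.
  rewrite expr1 expr0 !mul1r => Nd dR.
  have b := @harnack_base d t Nd dR.
  apply: (@le_trans _ _ A); last by rewrite lerDr W0.
  have [u0|u0] := leP 0 (- u (1 - d) t).
    by apply: le_trans b; rewrite ler_piMl//; lra.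
  by apply: le_trans A0; rewrite pmulr_rle0// ltW.
move=> dl du.
have Nk1 : 1 <= N ^+ k by rewrite exprn_ege1//; lra.
have Nd0 : 0 < N * d by rewrite mulr_gt0.
have Nd : N * d <= R1.
  apply: le_trans du; rewrite exprSr -mulrA -[leLHS]mul1r.
  by rewrite ler_pM2r.
have {IH} := IH (N * d) Nd0; rewrite !mulrA -!exprSr => /(_ dl du) IH.
have dNd : d <= N * d by rewrite ler_peMl//; lra.
have Wm : 4 * N * (N * d) * Phi (N * d / 2) <= 4 * N * d * Phi (d / 2).
  have := @Phi_mono (d / 2) (N * d / 2); rewrite divr_gt0// ler_pM2r// dNd.
  have NdR : N * d / 2 < R0 by lra.
  move=> /(_ isT isT NdR).
  rewrite -(ler_pM2l (_ : 0 < 8 * N)); last by rewrite mulr_gt0.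
  lra.
have W := W0 d d0 (le_trans dNd Nd).
set w := 4 * N * d * Phi (d / 2) in Wm W *.
have p5 : 1 <= 5 ^+ k :> R by rewrite exprn_ege1//; lra.
have step := @harnack_step d t d0 Nd.
have IH' : N * d * - u (1 - N * d) t <= 5 ^+ k * (w + A).
  apply: le_trans IH _; rewrite ler_pM2l; last lra.
  by rewrite lerD2r; move: Wm; rewrite !mulrA.
have Nm : N * d * Num.max 0 (- u (1 - N * d) t) <= 5 ^+ k * (w + A).
  rewrite maxr_pMr; last exact: ltW.
  by rewrite ge_max mulr0 IH' andbT mulr_ge0//; lra.
apply: (@le_trans _ _ (w + 4 * (5 ^+ k * (w + A)))).
  have := step; rewrite -(ler_pM2l d0) => /le_trans; apply.
  move: Nm; set m := Num.max _ _ => Nm.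
  have -> : d * (4 * N * (Phi (d / 2) + m)) = w + 4 * (N * d * m) by rewrite /w; ring.
  by rewrite lerD2l ler_pM2l.
have : w <= 5 ^+ k * (w + A).
  apply: (@le_trans _ _ (w + A)); first by rewrite lerDl.
  by rewrite ler_peMl// addr_ge0.
rewrite exprS; lra.
Qed.

End LowerBound.

(** * Proximate orders *)

Section ProximateOrder.
Context {R : realType}.
Implicit Types (s t : R).

Lemma limf_esup_lt (f : R -> \bar R) (F : set_system R) (a : R) : Filter F ->
  (limf_esup f F < a%:E)%E -> \forall x \near F, (f x < a%:E)%E.
Proof.
move=> FF /ereal_inf_lt[_ [V FV <-] Va]; apply: filterS FV => x Vx.
by apply: le_lt_trans Va; apply: ereal_sup_ubound; exists x.
Qed.

Lemma limf_einf_gt1_margin (f : R -> R) (F : set_system R) : Filter F ->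
  (1%:E < limf_einf (EFin \o f) F)%E ->
  exists2 c : R, 0 < c & \forall x \near F, 1 + c <= f x.
Proof.
move=> FF; rewrite /limf_einf lteNr.
have K : (limf_esup (\- (EFin \o f)) F < - 1%:E)%E ->
    exists2 b : R, b < -1 & (limf_esup (\- (EFin \o f)) F < b%:E)%E.
  case: limf_esup => [r| |] //=.
    rewrite lte_fin => r1; exists ((r - 1) / 2); first lra.
    by rewrite lte_fin; lra.
  by move=> _; exists (-2); [lra|exact: ltNyr].
move=> /K[b b1 Hb]; exists (- 1 - b); first by lra.
move/limf_esup_lt : Hb; apply: filterS => x /=.
by rewrite lte_fin; lra.
Qed.

Lemma limf_esup_ub (f : R -> R) (F : set_system R) : Filter F ->
  (limf_esup (EFin \o f) F < +oo)%E ->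
  exists S : R, \forall x \near F, f x <= S.
Proof.
move=> FF H.
have [S HS] : exists S : R, (limf_esup (EFin \o f) F < S%:E)%E.
  move: H; case: limf_esup => [r| |] //= _.
    by exists (r + 1); rewrite lte_fin; lra.
  by exists 0; exact: ltNyr.
by exists S; move/limf_esup_lt : HS; apply: filterS => x /=; rewrite lte_fin => /ltW.
Qed.

(** In the interior of the ray the one-sided restriction on the quotients is
    vacuous. *)
Lemma C1_ray_is_derive (t0 : R) (f df : R -> R) t : C1_ray t0 f df -> t0 < t ->
  is_derive t 1 f (df t).
Proof.
move=> [H _] t0t; have tt := H t (ltW t0t).
have D : h^-1 *: ((f \o shift t) (h *: 1) - f t) @[h --> 0^'] --> df t.
  apply/cvgrPdist_le => e e0.
  move/cvgrPdist_le : tt => /(_ e e0)[d /= d0 {}H].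
  exists (Num.min d (t - t0)); first by rewrite /= lt_min d0 subr_gt0.
  move=> h; rewrite /ball_ /= sub0r normrN lt_min => /andP[hd ht] h0.
  have := H (h + t); rewrite /ball_ /= opprD addrCA subrr addr0 normrN => /(_ hd).
  rewrite in_itv/= andbT -subr_eq0 addrK => /(_ h0).
  have th : t0 <= h + t by move: ht; rewrite ltr_norml; lra.
  by move=> /(_ th); rewrite mulrC [_ *: 1]mulr1.
split; first by apply/cvg_ex; exists (df t).
exact/cvg_lim.
Qed.

(** The change of variable [t = 1 / (1 - r)]. *)
Lemma near_left1_ray (P : R -> Prop) : (\forall r \near (1 : R)^'-, P r) ->
  exists2 T : R, 1 <= T & forall t, T <= t -> P (1 - t^-1).
Proof.
move=> [d /= d0 H]; exists (1 + d^-1); first by rewrite lerDl invr_ge0 ltW.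
have di : 0 < d^-1 by rewrite invr_gt0.
move=> t Tt; have t0 : 0 < t by lra.
have td : t^-1 < d by rewrite -[d]invrK ltf_pV2 ?posrE//; lra.
have ti : 0 < t^-1 by rewrite invr_gt0.
apply: H; last by rewrite ltrBlDr ltrDl.
by rewrite /ball_ /= opprB addrC subrK gtr0_norm.
Qed.

(** All the conditions that hold for large [t], collected above one threshold. *)
Lemma proximate_order_facts (t0 d : R) (sigma : R -> R) :
  generalized_proximate_order t0 sigma ->
  let lambda := fun r : R => sigma (1 / (1 - r)) in
  (1%:E < limf_einf (EFin \o lambda) (1 : R)^'-)%E ->
  (limf_esup (EFin \o lambda) (1 : R)^'- < +oo)%E ->
  0 < d ->
  exists T S c : R, exists dsigma : R -> R, [/\ t0 < T, 1 <= T, 0 < c &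
    forall t, T <= t -> [/\ 1 + c <= sigma t, sigma t <= S,
      is_derive t 1 sigma (dsigma t), `|dsigma t| * t * ln t <= c &
      `|dsigma t| * t * ln t <= d] ].
Proof.
move=> [t01 _ _ _ [ds dsP dslim]] /= infs sups d0.
have [c c0 /near_left1_ray [T1 T11 H1]] := limf_einf_gt1_margin _ infs.
have [S /near_left1_ray [T2 _ H2]] := limf_esup_ub _ sups.
have lam t : 1 <= t -> 1 / (1 - (1 - t^-1)) = t by move=> _; rewrite subKr div1r invrK.
have m0 : 0 < Num.min c d by rewrite lt_min c0.
have Hl : (0%E < (Num.min c d)%:E)%E by rewrite lte_fin.
rewrite -dslim in Hl; move: Hl => /limf_esup_lt [T3 [_ H3]].
exists (Num.max (Num.max T1 T2) (Num.max (T3 + 1) (t0 + 1))), S, c, ds.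
split => //.
- by rewrite !lt_max ltrDl ltr01 !orbT.
- by rewrite !le_max T11.
move=> t; rewrite !ge_max => /andP[/andP[tT1 tT2] /andP[tT3 tt0]].
have t1 : 1 <= t by exact: le_trans tT1.
have := H1 t tT1; have := H2 t tT2; rewrite !lam// => sS cs.
have := H3 t; rewrite lte_fin => /(_ ltac:(lra)).
rewrite lt_min => /andP[/ltW h1 /ltW h2].
split => //; apply: C1_ray_is_derive dsP _; lra.
Qed.

(** Logarithmically, [V t / t = t ^ (sigma t - 1)] is nondecreasing: the derivative
    of [(sigma t - 1) log t] is [(sigma t - 1 + sigma' t log t) / t], and the
    first part exceeds [c] while the second is at most [c] in absolute value. *)
Lemma order_log_mono (sigma dsigma : R -> R) (T c : R) : 1 <= T ->
  (forall t, T <= t -> [/\ 1 + c <= sigma t,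
     is_derive t 1 sigma (dsigma t) & `|dsigma t| * t * ln t <= c]) ->
  forall s t, T <= s -> s <= t -> (sigma s - 1) * ln s <= (sigma t - 1) * ln t.
Proof.
move=> T1 H.
have D x : T <= x -> is_derive x 1 (fun t => (sigma t - 1) * ln t)
    ((sigma x - 1) * x^-1 + ln x * dsigma x).
  move=> Tx; have [_ ds _] := H x Tx.
  have x0 : 0 < x by lra.
  have ln' := is_derive1_ln x0.
  have ds1 : is_derive x 1 (fun t => sigma t - 1) (dsigma x).
    by apply: is_derive_eq; rewrite subr0.
  exact: (is_deriveM ds1 ln').
apply: (@ger0_derive1_ndecry R (fun t => (sigma t - 1) * ln t) T).
- by move=> x; rewrite in_itv/= andbT => /ltW /D[].
- move=> x; rewrite in_itv/= andbT => /ltW Tx; rewrite derive1E (@derive_val _ _ _ _ _ _ _ (D x Tx)).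
  have [cs _ dc] := H x Tx; have x0 : 0 < x by lra.
  have lx : 0 <= ln x by rewrite ln_ge0//; lra.
  have : - (`|dsigma x| * ln x) <= ln x * dsigma x.
    by rewrite [leRHS]mulrC -mulNr ler_wpM2r// lerNl ler_normr lexx orbT.
  have : `|dsigma x| * ln x <= (sigma x - 1) * x^-1.
    rewrite ler_pdivlMr// mulrAC; lra.
  lra.
- apply: derivable_within_continuous => x.
  by rewrite in_itv/= andbT => /D[].
Qed.

(** By the mean value theorem, since [|sigma'| t <= |sigma'| t log t <= d] as soon
    as [log t >= 1]. *)
Lemma order_double (sigma dsigma : R -> R) (T d : R) : expR 1 <= T ->
  (forall t, T <= t ->
     is_derive t 1 sigma (dsigma t) /\ `|dsigma t| * t * ln t <= d) ->
  forall t, T <= t -> sigma (2 * t) <= sigma t + d.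
Proof.
move=> T1 H t Tt.
have e1 : 1 < expR 1 :> R by rewrite expR_gt1.
have t0 : 0 < t by lra.
have t2 : t < 2 * t by lra.
have [x|x|x] := @MVT R sigma dsigma t (2 * t) t2.
- by rewrite in_itv/= => /andP[tx _]; apply: (H x _).1; lra.
- move: x; apply: derivable_within_continuous => x; rewrite in_itv/= => /andP[tx _].
  by have [[]] := H x (le_trans Tt tx).
rewrite in_itv/= => /andP[tx x2t] E.
have [_ Hd] := H x ltac:(lra).
have lx : 1 <= ln x by rewrite -(@expRK R 1) ler_ln ?posrE ?expR_gt0//; lra.
have n0 := normr_ge0 (dsigma x).
have : dsigma x * (2 * t - t) <= d.
  apply: le_trans Hd; apply: (@le_trans _ _ (`|dsigma x| * x)).
    have -> : 2 * t - t = t by ring.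
    apply: (@le_trans _ _ (`|dsigma x| * t)); first by rewrite ler_pM2r// ler_norm.
    by rewrite ler_wpM2l// ltW.
  by rewrite ler_peMr// mulr_ge0//; lra.
by rewrite -E; lra.
Qed.

End ProximateOrder.

(** * Polar coordinates and powers *)

Section PolarAndPowers.
Import Normc.
Local Open Scope complex_scope.
Context {R : realType}.
Implicit Types (z w : R[i]).

(** The angle is [acos] of the normalised real part, reflected when the imaginary
    part is negative. *)
Lemma polar_surj z : exists2 t : R, 0 <= t < 2 * pi & z = polar (normc z) t.
Proof.
have [->|z0] := eqVneq z 0.
  exists 0; first by rewrite lexx mulr_gt0// pi_gt0.
  by rewrite normc0 /polar !mul0r.
have n0 : 0 < normc z by rewrite normc_gt0.
have nE : complex.Re z ^+ 2 + complex.Im z ^+ 2 = normc z ^+ 2.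
  by case: {n0 z0} z => x y /=; rewrite sqr_sqrtr// addr_ge0 ?sqr_ge0.
pose c := complex.Re z / normc z; pose s := complex.Im z / normc z.
have cs : c ^+ 2 + s ^+ 2 = 1.
  by rewrite /c /s !exprMn -mulrDl nE -exprMn divff ?expr1n// gt_eqF.
have zE : z = (normc z * c) +i* (normc z * s).
  rewrite /c /s ![normc z * _]mulrC !divfK ?gt_eqF//.
  by clear; case: z.
have c1 : -1 <= c <= 1.
  rewrite -ler_norml -(@expr_le1 _ 2)// real_normK ?num_real// -cs.
  by rewrite lerDl sqr_ge0.
have cK : cos (acos c) = c by rewrite acosK// in_itv.
have sA : sin (acos c) = `|s|.
  by rewrite sin_acos// -cs addrC addKr sqrtr_sqr.
have [s0|s0] := leP 0 s.
  exists (acos c).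
    rewrite acos_ge0//=; apply: le_lt_trans (acos_lepi c1) _.
    by have := pi_gt0 R; lra.
  by rewrite {1}zE /polar cK sA ger0_norm.
have a0 : 0 < acos c.
  rewrite lt_def acos_ge0// andbT; apply/eqP => ac.
  by move: sA; rewrite ac sin0 => /esym/eqP; rewrite normr_eq0 lt_eqF.
exists (2 * pi - acos c).
  by rewrite subr_ge0 ltrBlDr ltrDl a0 andbT; have := acos_lepi c1; have := pi_gt0 R; lra.
rewrite {1}zE /polar cosB sinB mulr_natl cos2pi sin2pi !mul0r !mul1r addr0 sub0r.
by rewrite cK sA ltr0_norm// opprK.
Qed.

Lemma div1_powR (x a : R) : 0 < x -> 1 / (x `^ a) = expR (a * ln x^-1).
Proof.
by move=> x0; rewrite /powR gt_eqF// div1r -expRN lnV ?posrE// mulrN.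
Qed.

Lemma pow_bracket (N x : R) : 2 <= N -> 1 <= x -> exists k, N ^+ k <= x < N ^+ k.+1.
Proof.
move=> N2 x1.
have ex : exists k, x < N ^+ k.+1.
  exists (Num.bound x); apply: (@lt_le_trans _ _ (Num.bound x)%:R).
    by apply: archi_boundP; lra.
  apply: (@le_trans _ _ (2 ^+ (Num.bound x).+1)).
    by rewrite -natrX ler_nat ltnW// (leq_trans (ltn_expl _ (ltnSn 1)))// leq_exp2l.
  by apply: lerXn2r => //; rewrite nnegrE; lra.
have := ex_minnP ex => -[[|k] xk kmin].
  by exists 0%N; rewrite expr0 x1.
exists k.+1; rewrite xk andbT leNgt; apply/negP => /kmin.
by rewrite ltnn.
Qed.

(** With [N = 5 ^ P], the number [k] of steps satisfies [N ^ k <= t], hence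
    [5 ^ k <= t ^ (1 / P)]. *)
Lemma pow5_le_small_power (e : R) : 0 < e -> exists P : nat, (0 < P)%N /\
  forall k t, 1 <= t -> (5 ^+ P) ^+ k <= t -> 5 ^+ k <= expR (e * ln t) :> R.
Proof.
move=> e0; exists (Num.bound e^-1).+1; split => // k t t1 kt.
have t0 : 0 < t by lra.
have lt0 : 0 <= ln t by rewrite ln_ge0.
have P0 : (0 : R) < (Num.bound e^-1).+1%:R by rewrite ltr0n.
have eP : e^-1 <= (Num.bound e^-1).+1%:R.
  apply: ltW; apply: lt_trans (archi_boundP _) _; first by rewrite invr_ge0 ltW.
  by rewrite ltr_nat.
have p5 : (0 : R) < 5 ^+ k by rewrite exprn_gt0.
rewrite -[leLHS]lnK ?posrE// ler_expR.
have : ln (5 ^+ k) * (Num.bound e^-1).+1%:R <= ln t.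
  rewrite mulr_natr -lnXn// ler_ln ?posrE ?exprn_gt0//.
  by rewrite exprAC.
rewrite -ler_pdivlMr// => /le_trans; apply.
rewrite mulrC ler_wpM2r// invf_ple ?posrE//.
Qed.

End PolarAndPowers.

(** * The theorem *)

Section Absorption.
Context {R : realType}.

(** Everything is written with [L = log t]: [sg] and [sg2] are the orders at [t] and
    [2 t], and [l2] is [log 2].  Of the spare exponent [3 e], one part pays for
    [sg2 - sg], one for the factor [p5], and one for the constants. *)
Lemma absorb_constants (e sg sg2 S L l2 N4 A p5 u : R) :
  0 < e -> 1 <= sg -> sg2 <= S -> sg2 <= sg + e -> 0 <= l2 -> 0 <= L ->
  0 <= N4 -> 0 <= A -> 0 <= p5 -> p5 <= expR (e * L) ->
  u <= p5 * (N4 * expR (sg2 * (l2 + L)) + A * expR L) ->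
  (N4 * expR (S * l2) + A) / e <= L ->
  u < expR ((1 + 3 * e) * sg * L).
Proof.
move=> e0 sg1 sS sge l20 L0 N0 A0 p0 pe uH CL.
set C := N4 * expR (S * l2) + A in CL.
have C0 : 0 <= C by rewrite addr_ge0// mulr_ge0// expR_ge0.
have h1 : expR (sg2 * (l2 + L)) <= expR (S * l2) * expR ((sg + e) * L).
  rewrite -expRD ler_expR mulrDr.
  by apply: lerD; exact: ler_wpM2r.
have h2 : expR L <= expR ((sg + e) * L).
  by rewrite ler_expR ler_peMl//; lra.
set X := expR ((sg + e) * L) in h1 h2.
have X0 : 0 <= X := expR_ge0 _.
have h3 : N4 * expR (sg2 * (l2 + L)) + A * expR L <= C * X.
  rewrite /C mulrDl -mulrA; apply: lerD; exact: ler_wpM2l.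
apply: le_lt_trans uH _.
apply: (@le_lt_trans _ _ (expR (e * L) * (C * X))).
  by apply: ler_pM => //; rewrite addr_ge0// mulr_ge0// expR_ge0.
apply: (@lt_le_trans _ _ (expR (e * L) * (expR (e * L) * X))).
  rewrite ltr_pM2l ?expR_gt0// ltr_pM2r ?expR_gt0//.
  apply: lt_le_trans (expR_ge1Dx _).
  by move: CL; rewrite ler_pdivrMr// mulrC; lra.
rewrite /X -!expRD ler_expR.
have : e * L <= sg * (e * L) by rewrite ler_peMl// mulr_ge0// ltW.
lra.
Qed.

End Absorption.

Theorem theorem5 (R : realType) (t0 : R) (sigma : R -> R) :
  generalized_proximate_order t0 sigma ->
  let lambda := fun r : R => sigma (1 / (1 - r)) in
  (1%:E < limf_einf (EFin \o lambda) (1 : R)^'-)%E ->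
  (limf_einf (EFin \o lambda) (1 : R)^'- <
     limf_esup (EFin \o lambda) (1 : R)^'-)%E ->
  (limf_esup (EFin \o lambda) (1 : R)^'- < +oo)%E ->
  forall (eps : R) (f : R[i] -> R[i]) (r0 : R),
    0 < eps ->
    analytic_in_disc f ->
    f 0 = 0 ->
    0 < r0 -> r0 < 1 -> 1 - 1 / t0 <= r0 ->
    (forall r theta : R, r0 < r -> r < 1 -> 0 <= theta -> theta < 2 * pi ->
       complex.Re (f (polar r theta)) < 1 / ((1 - r) `^ lambda r)) ->
  exists r1 : R, [/\ 0 < r1, r1 < 1 &
    forall r theta : R, r1 <= r -> r < 1 -> 0 <= theta -> theta < 2 * pi ->
      `|complex.Re (f (polar r theta))| <
        1 / ((1 - r) `^ ((1 + eps) * lambda r))].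
Proof.
move=> gpo lambda infs _ sups eps f r0 eps0 df f0 r00 r01 _ ub.
pose e := eps / 3; have e0 : 0 < e by rewrite divr_gt0.
have [T' [S [c [ds [_ T'1 c0 H]]]]] := proximate_order_facts gpo infs sups e0.
(* Beyond [expR 1] the logarithm is at least 1, as [order_double] requires. *)
have [T [TT' Te]] : exists T, T' <= T /\ expR 1 <= T.
  by exists (Num.max T' (expR 1)); rewrite !le_max !lexx orbT.
have T1 : 1 < T by apply: lt_le_trans Te; rewrite expR_gt1.
have mono : forall s t, T <= s -> s <= t ->
    (sigma s - 1) * ln s <= (sigma t - 1) * ln t.
  apply: (@order_log_mono _ sigma ds T c (ltW T1)) => t Tt.
  by have [? _ ? ? _] := H t (le_trans TT' Tt).
have dbl : forall t, T <= t -> sigma (2 * t) <= sigma t + e.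
  apply: (@order_double _ sigma ds T e Te) => t Tt.
  by have [_ _ ? _ ?] := H t (le_trans TT' Tt).
have sig1 t : T <= t -> 1 <= sigma t.
  by move=> /(le_trans TT')/H[? _ _ _ _]; lra.
have sigS t : T <= t -> sigma t <= S by move=> /(le_trans TT')/H[].
have [P [P0 loss]] := pow5_le_small_power e0.
pose N : R := 5 ^+ P.
have N2 : 2 <= N.
  have : (5 : R) ^+ 1 <= 5 ^+ P by rewrite ler_eXn2l//; lra.
  by rewrite /N expr1; lra.
(* At a distance at most [R0] from the unit circle, both the upper bound on
   [Re f] and the monotonicity of [V t / t] are available. *)
pose R0 := Num.min (1 - r0) T^-1.
have Ti0 : 0 < T^-1 by rewrite invr_gt0; lra.
have R00 : 0 < R0 by rewrite /R0 lt_min subr_gt0 r01.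
have R0T : R0 <= T^-1 by rewrite /R0 ge_min lexx orbT.
have Ti1 : T^-1 < 1 by rewrite invf_lt1//; lra.
have R01 : R0 <= 1 by lra.
have R0r : R0 <= 1 - r0 by rewrite /R0 ge_min lexx.
have big x : 0 < x -> x <= R0 -> T <= x^-1.
  move=> x0 xR; rewrite -[T]invrK lef_pV2 ?posrE//; exact: le_trans xR R0T.
pose Phi x := expR (sigma x^-1 * ln x^-1).
have dfn z : Normc.normc z < 1 -> Cdiff f z.
  by move=> z1; apply: df; rewrite normE ltcR.
have fPhi z : 1 - R0 < Normc.normc z -> Normc.normc z < 1 ->
    complex.Re (f z) <= Phi (1 - Normc.normc z).
  move=> zl z1; have [t /andP[t00 t2] zE] := polar_surj z.
  rewrite {1}zE; have rz : r0 < Normc.normc z by lra.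
  have := ub _ t rz z1 t00 t2.
  rewrite div1_powR ?subr_gt0// /lambda div1r; exact: ltW.
have Phi0 x : 0 < x -> x < R0 -> 0 <= Phi x by move=> _ _; exact: expR_ge0.
have PhiM x y : 0 < x -> x <= y -> y < R0 -> y * Phi y <= x * Phi x.
  move=> x0 xy yR; have y0 := lt_le_trans x0 xy.
  have E v : 0 < v -> v * Phi v = expR ((sigma v^-1 - 1) * ln v^-1).
    move=> v0; rewrite /Phi -{1}[v]lnK ?posrE// -expRD lnV ?posrE//.
    by congr expR; ring.
  rewrite !E// ler_expR; apply: mono; first by apply: big => //; exact: ltW.
  by rewrite lef_pV2 ?posrE.
have iter := @lower_bound_iter R f Phi R0 N dfn f0 R00 R01 N2 fPhi Phi0 PhiM.
cbv zeta in iter; set A := 4 * N / (R0 / 2) * _ in iter.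
have A0 : 0 <= A.
  by rewrite /A mulr_ge0 ?expR_ge0// divr_ge0//; lra.
pose C := 4 * N * expR (S * ln 2) + A.
(* Being beyond [2 / R0] puts the point within reach of the iteration; beyond
   [expR (C / e)] the constant [C] is at most [t ^ e]. *)
pose T2 := Num.max (Num.max T (2 / R0)) (expR (C / e)).
have TT2 : T <= T2 by rewrite /T2 !le_max lexx.
have RT2 : 2 / R0 <= T2 by rewrite /T2 !le_max lexx orbT.
have CT2 : expR (C / e) <= T2 by rewrite /T2 !le_max lexx orbT.
have T20 : 0 < T2 by lra.
exists (1 - T2^-1); split.
- by rewrite subr_gt0 invf_lt1//; lra.
- by rewrite ltrBlDr ltrDl invr_gt0.
move=> r th rT r1 th0 th2; pose d := 1 - r; pose t := d^-1.
have d0 : 0 < d by rewrite subr_gt0.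
have t0' : 0 < t by rewrite invr_gt0.
have tT2 : T2 <= t.
  by rewrite -[T2]invrK lef_pV2 ?posrE ?invr_gt0// /d; lra.
have Tt : T <= t by exact: le_trans tT2.
have t1 : 1 < t by exact: lt_le_trans Tt.
have dR1 : d <= R0 / 2.
  rewrite -[d]invrK -[R0 / 2]invrK lef_pV2 ?posrE ?invr_gt0 ?divr_gt0//.
  by rewrite invf_div (le_trans RT2).
have L0 : 0 <= ln t by rewrite ln_ge0// ltW.
have rE : r = 1 - d by rewrite /d; ring.
rewrite div1_powR// -/d -/t /lambda div1r -/d -/t ltr_norml ltrNl; apply/andP; split.
  have [k /andP[kl ku]] := @pow_bracket R N (R0 / 2 / d) N2 ltac:(by rewrite ler_pdivlMr// mul1r).
  have := iter k d th d0; rewrite -ltr_pdivrMr// -ler_pdivlMr// => /(_ ku kl).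
  rewrite -rE -(ler_pM2l t0') mulrA mulVf ?gt_eqF// mul1r => low.
  have -> : (1 + eps) * sigma t * ln t = (1 + 3 * e) * sigma t * ln t.
    by rewrite /e; field.
  have p5 : 5 ^+ k <= expR (e * ln t).
    apply: loss; first exact: ltW.
    apply: le_trans kl _; rewrite -[leRHS]mul1r ler_pM2r//; lra.
  apply: (@absorb_constants _ e (sigma t) (sigma (2 * t)) S (ln t) (ln 2) (4 * N) A (5 ^+ k)) => //.
  - exact: sig1.
  - by apply: sigS; lra.
  - exact: dbl.
  - by rewrite ln_ge0//; lra.
  - lra.
  - rewrite -lnM ?posrE// lnK ?posrE//.
    apply: le_trans low _; rewrite /Phi invf_div le_eqVlt; apply/orP; left; apply/eqP.
    by rewrite -/t /t; field; rewrite gt_eqF.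
  - by rewrite -[leLHS]expRK ler_ln ?posrE ?expR_gt0// (le_trans CT2).
have rr0 : r0 < r by rewrite rE; lra.
have := ub r th rr0 r1 th0 th2.
rewrite div1_powR// /lambda div1r -/d -/t => /lt_le_trans; apply.
rewrite ler_expR ler_wpM2r// ler_peMl//; last lra.
by apply: le_trans (sig1 t Tt).
Qed.
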